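(* Let $\eta_0:\mathbb{R}\to[0,\infty)$ be a nonnegative Riemann integrable function of compact support. Then there exist a complex separable Hilbert space and bounded self-adjoint operators $A,B$ on it with $(A-B)\in\mathcal{I}_2$ such that $\eta(\,\cdot\,;A,B)=\eta_0$ a.e. on $\mathbb{R}$, where $\eta(\,\cdot\,;A,B)$ is the Koplienko spectral shift function of the pair $A,B$. In other words, the class $\eta(\mathcal{I}_2)=\{\eta(\,\cdot\,;A,B)\mid A,B \text{ bounded and self-adjoint}, (A-B)\in\mathcal{I}_2\}$ contains all nonnegative Riemann integrable functions of compact support.
   Context: All Hilbert spaces are complex and separable. $\mathcal{I}_1$ denotes the trace class and $\mathcal{I}_2$ the Hilbert--Schmidt class. Koplienko spectral shift function (KoSSF): for bounded self-adjoint operators $A,B$ with $(A-B)\in\mathcal{I}_2$, $\eta(\,\cdot\,;A,B)$ is the unique function in $L^1(\mathbb{R};d\lambda)$ vanishing a.e. outside $(-\max(\|A\|,\|B\|),\max(\|A\|,\|B\|))$ such that for every $g\in C^\infty(\mathbb{R})$ the operator $g(A)-g(B)-\frac{d}{d\alpha}g(B+\alpha(A-B))\big|_{\alpha=0}$ is trace class and $$\operatorname{Tr}\Big(g(A)-g(B)-\frac{d}{d\alpha}g(B+\alpha(A-B))\Big|_{\alpha=0}\Big)=\int_{\mathbb{R}}g''(\lambda)\,\eta(\lambda;A,B)\,d\lambda .$$ *)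

(* Defs.v *)
From HB Require Import structures.
From mathcomp Require Import all_boot all_order all_algebra.
From mathcomp Require Import all_classical all_reals all_analysis.
From mathcomp Require Import complex.

Set Implicit Arguments.
Unset Strict Implicit.
Unset Printing Implicit Defensive.

Import Order.TTheory GRing.Theory Num.Theory.
Import numFieldNormedType.Exports.

Local Open Scope classical_set_scope.
Local Open Scope ring_scope.
Local Open Scope complex_scope.

(* The real part is qualified throughout: [Re] alone may also refer to the
   numClosedFieldType operation, which takes its values in [R[i]]. *)
Local Notation Re := complex.Re.
Local Notation Im := complex.Im.

Section darboux.
Context {R : realType}.
Implicit Types (f : R -> R) (a b : R) (s : seq R).

(* The partition is [a :: s], as in [itv_partition a b s]; its i-th cell is
   the closed interval from [nth a (a :: s) i] to [nth a s i]. *)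
Definition cell_image f a s (i : nat) : set R :=
  f @` `[nth a (a :: s) i, nth a s i].

Definition cell_length a s (i : nat) : R := nth a s i - nth a (a :: s) i.

Definition lower_sum f a s : R :=
  \sum_(i < size s) inf (cell_image f a s i) * cell_length a s i.

Definition upper_sum f a s : R :=
  \sum_(i < size s) sup (cell_image f a s i) * cell_length a s i.

Definition lower_integral f a b : R :=
  sup [set lower_sum f a s | s in itv_partition a b].

Definition upper_integral f a b : R :=
  inf [set upper_sum f a s | s in itv_partition a b].

(* The bound makes every [sup] and [inf] above a genuine one. *)
Definition riemann_integrable_on f a b : Prop :=
  (exists M, forall x, a <= x <= b -> `|f x| <= M) /\
  lower_integral f a b = upper_integral f a b.

Definition compactly_supported f : Prop :=
  compact (closure [set x | f x != 0]).

(* For a function vanishing outside some compact interval; the choice of that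
   interval is immaterial. *)
Definition riemann_integrable f : Prop :=
  exists a b, [/\ a < b, forall x, f x != 0 -> a <= x <= b &
                  riemann_integrable_on f a b].

End darboux.

(* The inner product is linear in its first argument. *)
HB.mixin Record NormedModule_isHilbert (R : realType) (H : Type)
    of CompleteNormedModule R[i] H := {
  inner : {dot H for (@Num.conj R[i])} ;
  normr_inner : forall x : H, `|x| ^+ 2 = inner x x
}.

#[short(type="hilbertType")]
HB.structure Definition Hilbert (R : realType) :=
  {H of NormedModule_isHilbert R H & CompleteNormedModule R[i] H}.

Definition separable_space (T : topologicalType) : Prop :=
  exists2 D : set T, countable D & dense D.

Section operators.
Context {R : realType} {H : hilbertType R}.
Implicit Types (A B T : H -> H) (e : nat -> H).

(* Norms of vectors are elements of [R[i]], hence the real part. *)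
Definition opnorm T : \bar R :=
  ereal_sup [set (Re `|T x|)%:E | x in [set x : H | `|x| <= 1]].

Definition bounded_op T : Prop := linear T /\ (opnorm T < +oo)%E.

Definition self_adjoint T : Prop :=
  forall x y, inner (T x) y = inner x (T y).

(* In [R[i]], [0 <= z] says that [z] is real and nonnegative. *)
Definition positive_op T : Prop :=
  bounded_op T /\ forall x, 0 <= inner (T x) x.

(* Zero vectors are allowed among the [e n], so that sequences also describe
   the finite bases; they do not contribute to any of the sums below. *)
Definition orthonormal_basis e : Prop :=
  [/\ forall n, e n = 0 \/ `|e n| = 1,
      forall m n, m <> n -> inner (e m) (e n) = 0 &
      forall x, (forall n, inner x (e n) = 0) -> x = 0].

Definition hilbert_schmidt T : Prop :=
  bounded_op T /\
  exists2 e, orthonormal_basis e &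
    (\sum_(0 <= n <oo) ((Re `|T (e n)|) ^+ 2)%:E < +oo)%E.

(* The absolute value (T^* T)^(1/2). *)
Definition is_absop T P : Prop :=
  positive_op P /\ forall x y, inner (P x) (P y) = inner (T x) (T y).

Definition trace_class T : Prop :=
  bounded_op T /\
  exists2 P, is_absop T P &
  exists2 e, orthonormal_basis e &
    (\sum_(0 <= n <oo) (Re (inner (P (e n)) (e n)))%:E < +oo)%E.

(* The type [R[i]^o] carries the usual topology of the complex plane. *)
Definition is_trace T (t : R[i]) : Prop :=
  forall e, orthonormal_basis e ->
    series (fun n => inner (T (e n)) (e n) : R[i]^o) @ \oo --> (t : R[i]^o).

Definition op_poly (p : {poly R[i]}) T : H -> H :=
  fun x => \sum_(k < size p) p`_k *: iter k T x.

(* g(A) is the limit in operator norm of p_n(A), for polynomials p_n that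
   converge to g uniformly on [- |A|, |A|], an interval which contains the
   spectrum of the self-adjoint operator A. *)
Definition is_funcalc A (g : R -> R[i]) T : Prop :=
  bounded_op T /\
  exists2 p : nat -> {poly R[i]},
    {uniform `[- fine (opnorm A), fine (opnorm A)],
       (fun n (x : R) => (p n).[x%:C] : R[i]^o) @ \oo --> (g : R -> R[i]^o)} &
    opnorm (op_poly (p n) A - T) @[n --> \oo] --> 0%E.

(* T is the derivative at 0, in operator norm, of the path F. *)
Definition is_op_derive0 (F : R -> H -> H) T : Prop :=
  bounded_op T /\
  opnorm ((h^-1)%:C *: (F h - F 0) - T) @[h --> 0^'] --> 0%E.

End operators.

Section koplienko.
Context {R : realType}.

Definition smooth (f : R -> R) : Prop :=
  forall n x, derivable (derive1n n f) x 1.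

Definition csmooth (g : R -> R[i]) : Prop :=
  smooth (fun x => Re (g x)) /\ smooth (fun x => Im (g x)).

Definition cderive2 (g : R -> R[i]) (x : R) : R[i] :=
  derive1n 2 (fun y => Re (g y)) x +i* derive1n 2 (fun y => Im (g y)) x.

Definition cintegral (f : R -> R[i]) : R[i] :=
  (\int[lebesgue_measure]_x Re (f x)) +i* (\int[lebesgue_measure]_x Im (f x)).

(* The operator g(A) - g(B) - d/dt g(B + t (A - B)) at t = 0. *)
Definition is_koplienko_remainder {H : hilbertType R} (A B : H -> H)
    (g : R -> R[i]) (T : H -> H) : Prop :=
  exists (GA GB D : H -> H) (F : R -> H -> H),
    [/\ is_funcalc A g GA, is_funcalc B g GB,
        forall t : R, is_funcalc (B + t%:C *: (A - B)) g (F t),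
        is_op_derive0 F D & T = GA - GB - D].

Definition koplienko_formula {H : hilbertType R} (A B : H -> H)
    (eta : R -> R) : Prop :=
  [/\ lebesgue_measure.-integrable setT (EFin \o eta),
      {ae lebesgue_measure, forall x : R,
         Num.max (fine (opnorm A)) (fine (opnorm B)) <= `|x| -> eta x = 0} &
      forall g : R -> R[i], csmooth g ->
        exists2 T : H -> H, is_koplienko_remainder A B g T &
          trace_class T /\
          is_trace T (cintegral (fun x => cderive2 g x * (eta x)%:C))].

(* Being unique, the spectral shift function is the class modulo a.e. equality
   of any [eta] with this property. *)
Definition is_KoSSF {H : hilbertType R} (A B : H -> H) (eta : R -> R) : Prop :=
  koplienko_formula A B eta /\
  forall eta' : R -> R, koplienko_formula A B eta' ->
    {ae lebesgue_measure, forall x : R, eta' x = eta x}.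

End koplienko.

(* Main.v *)
From HB Require Import structures.
From mathcomp Require Import all_boot all_order all_algebra.
From mathcomp Require Import all_classical all_reals all_analysis.
From mathcomp Require Import measurable_realfun complex ring lra.
Require Import Defs.

Set Implicit Arguments.
Unset Strict Implicit.
Unset Printing Implicit Defensive.

Import Order.TTheory GRing.Theory Num.Theory.
Import numFieldNormedType.Exports.

Local Open Scope classical_set_scope.
Local Open Scope ring_scope.
Local Open Scope complex_scope.

Local Notation Re := complex.Re.
Local Notation Im := complex.Im.

(** Take A = diag(a_n) and B = diag(b_n) on l^2. By Taylor's formula with
    integral remainder, the one-dimensional pair (a, b) has as spectral shift
    function the right triangle |a - x| over the interval between a and b, so
    that the pair A, B has the sum of these triangles; A - B is Hilbert-Schmidt
    as soon as the sum is integrable. The pairs (a, b) and (b, a) together give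
    a square of side |a - b| standing on the interval, and squares of dyadic
    sides can be piled up under a nonnegative function f, greedily at each
    scale, so as to reach f at every point of lower semicontinuity, that is,
    almost everywhere if f is Riemann integrable. The functional calculus and
    the derivative of t |-> g(B + t (A - B)) exist because everything is
    diagonal, and the shift function is unique because its moments are
    prescribed by polynomial g. *)

(** * The Hilbert space l^2 *)

(** Two universal quantifiers in the definitions shape the proof. A trace must come out the same in
    every orthonormal basis [e]: the n-th diagonal entry of [diag c] in the basis [e] is the sum of
    the [c k] with weights [|<std k, e n>|^2], which add up to 1 over n by Parseval, so that an
    exchange of summations recovers the sum of [c]. A rival shift function brings its own remainder
    [T], made from its own functional calculus and derivative: the diagonal entries of [T] in the
    standard basis are shown to be forced, hence its trace, hence all moments of the rival. All the
    summability rests on one bound: the partial sums of the triangles stay below a constant [C] and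
    vanish outside [[-M, M]]. Dominated convergence then integrates [g''] term by term. The case
    [g = x^2] yields that the [(a n - b n)^2] are summable; this is the Hilbert-Schmidt property,
    and with the quadratic Taylor bound it makes the remainder trace class for every smooth [g].
    Stacking squares below [f] supplies [C], as no partial sum ever exceeds [f]. *)

Section complex_series.
Context {R : realType}.
Implicit Types (z w c : R[i]) (u v : nat -> R[i]).

Definition sqnorm z : R := Re z ^+ 2 + Im z ^+ 2.

Lemma sqnorm_ge0 z : 0 <= sqnorm z.
Proof. by rewrite addr_ge0 ?sqr_ge0. Qed.

Lemma sqnorm_eq0 z : (sqnorm z == 0) = (z == 0).
Proof.
by case: z => a b; rewrite /sqnorm paddr_eq0 ?sqr_ge0// !sqrf_eq0 eq_complex.
Qed.

Lemma sqnormE z : (sqnorm z)%:C = `|z| ^+ 2.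
Proof. exact: add_Re2_Im2. Qed.

Lemma sqnormM z w : sqnorm (z * w) = sqnorm z * sqnorm w.
Proof. by case: z w => [a b] [c d]; rewrite /sqnorm/=; ring. Qed.

Lemma sqnormJ z : sqnorm (Num.conj z) = sqnorm z.
Proof. by case: z => [a b]; rewrite /sqnorm/= sqrrN. Qed.

Lemma sqnormD_le z w : sqnorm (z + w) <= 2 * (sqnorm z + sqnorm w).
Proof.
case: z w => [a b] [c d]; rewrite /sqnorm/=.
have := sqr_ge0 (a - c); have := sqr_ge0 (b - d); nra.
Qed.

Lemma Re_add z w : Re (z + w) = Re z + Re w. Proof. by case: z w => [? ?] []. Qed.
Lemma Im_add z w : Im (z + w) = Im z + Im w. Proof. by case: z w => [? ?] []. Qed.
Lemma Re_opp z : Re (- z) = - Re z. Proof. by case: z. Qed.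
Lemma Im_opp z : Im (- z) = - Im z. Proof. by case: z. Qed.
Lemma Re_mul z w : Re (z * w) = Re z * Re w - Im z * Im w.
Proof. by case: z w => [? ?] []. Qed.
Lemma Im_mul z w : Im (z * w) = Re z * Im w + Im z * Re w.
Proof. by case: z w => [? ?] []. Qed.
Lemma Re_conj z : Re (Num.conj z) = Re z. Proof. by case: z. Qed.
Lemma Im_conj z : Im (Num.conj z) = - Im z. Proof. by case: z. Qed.

(** The arithmetic-geometric mean inequality without its factor 1/2: it dominates the terms of an
    inner product by a summable sequence. *)
Lemma abs_ReM_conj_le z w : `|Re (z * Num.conj w)| <= sqnorm z + sqnorm w.
Proof.
case: z w => [a b] [c d]; rewrite /sqnorm/= ler_norml.
have := sqr_ge0 (a - c); have := sqr_ge0 (b - d).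
by have := sqr_ge0 (a + c); have := sqr_ge0 (b + d) => *; apply/andP; split; nra.
Qed.

Lemma abs_ImM_conj_le z w : `|Im (z * Num.conj w)| <= sqnorm z + sqnorm w.
Proof.
case: z w => [a b] [c d]; rewrite /sqnorm/= ler_norml.
have := sqr_ge0 (a - d); have := sqr_ge0 (b - c).
by have := sqr_ge0 (a + d); have := sqr_ge0 (b + c) => *; apply/andP; split; nra.
Qed.

Lemma Re_sum (I : Type) (r : seq I) (P : pred I) (F : I -> R[i]) :
  Re (\sum_(i <- r | P i) F i) = \sum_(i <- r | P i) Re (F i).
Proof. by elim/big_rec2 : _ => // i x y _; rewrite Re_add => ->. Qed.

Lemma Im_sum (I : Type) (r : seq I) (P : pred I) (F : I -> R[i]) :
  Im (\sum_(i <- r | P i) F i) = \sum_(i <- r | P i) Im (F i).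
Proof. by elim/big_rec2 : _ => // i x y _; rewrite Im_add => ->. Qed.

(** Complex series are split into two real series, so that real comparison tests and limit rules
    apply to each. *)
Definition csummable u : Prop :=
  cvgn [series `|Re (u k)|]_k /\ cvgn [series `|Im (u k)|]_k.

Definition csum u : R[i] :=
  limn [series Re (u k)]_k +i* limn [series Im (u k)]_k.

Lemma csummable_Re u : csummable u -> cvgn [series Re (u k)]_k.
Proof. by case=> + _; exact: normed_cvg. Qed.

Lemma csummable_Im u : csummable u -> cvgn [series Im (u k)]_k.
Proof. by case=> _; exact: normed_cvg. Qed.

Lemma series_abs_cvg (a b : R^nat) :
  (forall n, `|a n| <= b n) -> cvgn (series b) -> cvgn [series `|a k|]_k.
Proof.
move=> ab; apply: series_le_cvg => [n|n|//]; first exact: normr_ge0.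
exact: le_trans (normr_ge0 _) (ab n).
Qed.

Lemma csummableP u (b : R^nat) :
  (forall n, `|Re (u n)| <= b n) -> (forall n, `|Im (u n)| <= b n) ->
  cvgn (series b) -> csummable u.
Proof. by move=> Rb Ib cb; split; apply: series_abs_cvg cb. Qed.

Lemma cvg_seriesD (a b : R^nat) : cvgn (series a) -> cvgn (series b) ->
  cvgn (series (fun k => a k + b k)).
Proof. by move=> ca cb; rewrite -[X in series X]/(a + b) seriesD; exact: is_cvgD. Qed.

Lemma cvg_seriesZ (c : R) (a : R^nat) : cvgn (series a) ->
  cvgn (series (fun k => c * a k)).
Proof. by move=> ca; rewrite -[X in series X]/(c *: a) seriesZ; exact: is_cvgZr. Qed.

Lemma limn_seriesD (a b : R^nat) : cvgn (series a) -> cvgn (series b) ->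
  limn (series (fun k => a k + b k)) = limn (series a) + limn (series b).
Proof. by move=> ca cb; rewrite -[X in series X]/(a + b) seriesD limD. Qed.

Lemma limn_seriesZ (c : R) (a : R^nat) : cvgn (series a) ->
  limn (series (fun k => c * a k)) = c * limn (series a).
Proof. by move=> ca; rewrite -[X in series X]/(c *: a) seriesZ limZr. Qed.

Lemma csum_lin c u v : csummable u -> csummable v ->
  csum (fun k => c * u k + v k) = c * csum u + csum v.
Proof.
move=> su sv.
have cuR := csummable_Re su; have cuI := csummable_Im su.
have cvR := csummable_Re sv; have cvI := csummable_Im sv.
apply/eqP; rewrite eq_complex Re_add Im_add Re_mul Im_mul /csum/=; apply/andP; split.
  under eq_fun do rewrite Re_add Re_mul -mulNr.
  have ca := cvg_seriesZ (c := Re c) cuR; have cb := cvg_seriesZ (c := - Im c) cuI.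
  by rewrite (limn_seriesD (cvg_seriesD ca cb) cvR) (limn_seriesD ca cb)
     !limn_seriesZ// mulNr.
under eq_fun do rewrite Im_add Im_mul.
have ca := cvg_seriesZ (c := Re c) cuI; have cb := cvg_seriesZ (c := Im c) cuR.
by rewrite (limn_seriesD (cvg_seriesD ca cb) cvI) (limn_seriesD ca cb) !limn_seriesZ.
Qed.

Lemma csum_conj u : csummable u -> csum (fun k => Num.conj (u k)) = Num.conj (csum u).
Proof.
move=> su; apply/eqP; rewrite eq_complex Re_conj Im_conj /csum/=.
under eq_fun do rewrite Re_conj.
rewrite eqxx/=; apply/eqP.
under eq_fun do rewrite Im_conj -mulN1r.
by rewrite limn_seriesZ ?mulN1r//; exact: csummable_Im.
Qed.

End complex_series.

Section l2_space.
Variable R : realType.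
Definition square_summable (x : nat -> R[i]) : Prop := cvgn [series sqnorm (x k)]_k.

Definition l2_pred : {pred nat -> R[i]} := fun x => `[< square_summable x >].

Lemma square_summable_dot (x y : nat -> R[i]) : square_summable x -> square_summable y ->
  csummable (fun k => x k * Num.conj (y k)).
Proof.
move=> sx sy; apply: csummableP (cvg_seriesD sx sy) => n.
  exact: (abs_ReM_conj_le (x n) (y n)).
exact: (abs_ImM_conj_le (x n) (y n)).
Qed.

Lemma l2_submod_closed : submod_closed l2_pred.
Proof.
split=> [|c x y /asboolP sx /asboolP sy]; apply/asboolP.
  rewrite /square_summable (_ : series _ = cst 0); first exact: is_cvg_cst.
  by apply/funext => n; rewrite /series/= big1// => k _; rewrite /sqnorm !expr0n addr0.
apply: (series_le_cvg (v_ := fun k => 2 * (sqnorm c * sqnorm (x k) + sqnorm (y k)))).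
- by move=> n; exact: sqnorm_ge0.
- by move=> n; rewrite mulr_ge0// addr_ge0 ?mulr_ge0 ?sqnorm_ge0.
- by move=> n; rewrite -sqnormM; exact: sqnormD_le.
- by apply: cvg_seriesZ; apply: cvg_seriesD => //; exact: cvg_seriesZ.
Qed.

HB.instance Definition _ :=
  GRing.isSubmodClosed.Build R[i] (nat -> R[i]) l2_pred l2_submod_closed.

Record l2 := L2 { l2seq :> nat -> R[i]; l2seqP : l2seq \in l2_pred }.

HB.instance Definition _ := [isSub for l2seq].
HB.instance Definition _ := [Choice of l2 by <:].
HB.instance Definition _ := [SubChoice_isSubLmodule of l2 by <:].

Lemma l2_ext (x y : l2) : (forall k, x k = y k) -> x = y.
Proof. by move=> xy; apply/val_inj/funext. Qed.

Lemma l2_summable (x : l2) : square_summable x.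
Proof. by apply/asboolP; exact: l2seqP. Qed.

Lemma l2D (x y : l2) k : (x + y) k = x k + y k. Proof. by []. Qed.

Lemma l2B (x y : l2) k : (x - y) k = x k - y k. Proof. by []. Qed.
Lemma l2Z c (x : l2) k : (c *: x) k = c * x k. Proof. by []. Qed.
Lemma l20 k : (0 : l2) k = 0. Proof. by []. Qed.

Lemma l2dot_summable (x y : l2) : csummable (fun k => x k * Num.conj (y k)).
Proof. apply: square_summable_dot; exact: l2_summable. Qed.

Definition l2dot (x y : l2) : R[i] := csum (fun k => x k * Num.conj (y k)).

Lemma l2dot_hermitian (x y : l2) : l2dot x y = (-1) ^+ false * Num.conj (l2dot y x).
Proof.
rewrite mul1r /l2dot -csum_conj; last exact: l2dot_summable.
by congr csum; apply/funext => k; rewrite rmorphM/= conjCK mulrC.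
Qed.

Lemma l2dot_linearl (y : l2) c (x x' : l2) : l2dot (c *: x + x') y = c * l2dot x y + l2dot x' y.
Proof.
rewrite /l2dot -csum_lin; [|exact: l2dot_summable..].
by congr csum; apply/funext => k; rewrite l2D l2Z mulrDl mulrA.
Qed.

Lemma l2dot_bilinear : bilinear_for *%R (Num.conj \; *%R) l2dot.
Proof.
split=> [y c x x'|y c x x']; first exact: l2dot_linearl.
rewrite l2dot_hermitian mul1r l2dot_linearl rmorphD rmorphM.
by rewrite [l2dot y x]l2dot_hermitian [l2dot y x']l2dot_hermitian !mul1r.
Qed.

Lemma dot_series_diag (x : l2) :
  (fun k => x k * Num.conj (x k)) = (fun k => (sqnorm (x k))%:C).
Proof. by apply/funext => k; rewrite sqnormE normCK. Qed.

Lemma l2dotxx (x : l2) : l2dot x x = (limn [series sqnorm (x k)]_k)%:C.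
Proof.
rewrite /l2dot dot_series_diag /csum/=; congr (_ +i* _).
rewrite (_ : series _ = cst 0); first exact: lim_cst.
by apply/funext => n; rewrite /series/= big1.
Qed.

Lemma sqnorm_sum_le (x : l2) n : \sum_(k < n) sqnorm (x k) <= limn [series sqnorm (x k)]_k.
Proof.
have nd : nondecreasing_seq [series sqnorm (x k)]_k.
  by apply/nondecreasing_seqP => m; rewrite /series/= big_nat_recr//= lerDl sqnorm_ge0.
by have := nondecreasing_cvgn_le nd (@l2_summable x) n; rewrite /series/= big_mkord.
Qed.

Lemma l2dot_gt0 (x : l2) : x != 0 -> 0 < l2dot x x.
Proof.
move=> x0; rewrite l2dotxx ltcR lt_neqAle; apply/andP; split.
  apply: contra x0 => /eqP x0; apply/eqP/l2_ext => k.
  have : sqnorm (x k) <= 0.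
    rewrite x0; apply: le_trans (sqnorm_sum_le x k.+1).
    by rewrite big_ord_recr/= lerDr sumr_ge0// => i _; exact: sqnorm_ge0.
  by rewrite l20 => h; apply/eqP; rewrite -sqnorm_eq0 eq_le h sqnorm_ge0.
by have := sqnorm_sum_le x 0; rewrite big_ord0.
Qed.

HB.instance Definition _ := bilinear_isBilinear.Build R[i] l2 l2 R[i]
  *%R (Num.conj \; *%R) l2dot l2dot_bilinear.
HB.instance Definition _ := isHermitianSesquilinear.Build R[i] l2 false
  Num.conj l2dot l2dot_hermitian.
HB.instance Definition _ := isDotProduct.Build R[i] l2 l2dot l2dot_gt0.

Local Notation dot := (l2dot : {dot l2 for Num.conj}).

Lemma l2dot_eq0 (x : l2) : l2dot x x = 0 -> x = 0.
Proof. by move=> /eqP; rewrite -[l2dot]/(dot : l2 -> l2 -> _) dnorm_eq0 => /eqP. Qed.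

End l2_space.

(** * Cauchy-Schwarz and triangle inequalities for an abstract dot product *)

Section cauchy_schwarz.
Variables (C : numClosedFieldType) (U : lmodType C) (form : {dot U for Num.conj}).
Local Notation "''[' u , v ]" := (form u v) : ring_scope.
Local Notation "''[' u ]" := '[u, u] : ring_scope.

(** Pythagoras for the decomposition of [u] into its projection [a *: v] and a vector orthogonal to
    [v]; dropping the orthogonal part gives the inequality. *)
Lemma dot_cauchy_schwarz u v : `|'[u, v]| ^+ 2 <= '[u] * '[v].
Proof.
have [->|v0] := eqVneq v 0; first by rewrite linear0r normr0 expr0n/= mulr_ge0.
pose a := '[u, v] / '[v].
have ou : '[u - a *: v, v] = 0.
  by rewrite linearBl/= linearZl_LR/= divfK ?dnorm_eq0// subrr.
rewrite -[u](subrK (a *: v)) linearDl/= ou add0r linearZl_LR/=.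
rewrite normrM (ger0_norm (dnorm_ge0 form v)) exprMn [X in _ <= X * _]hnormDd/=; last first.
  by rewrite linearZr_LR/= ou mulr0.
by rewrite dnormZ mulrDl -!mulrA -expr2 lerDr mulr_ge0.
Qed.

Lemma dot_cauchy_schwarz_sqrt u v : `|'[u, v]| <= sqrtC '[u] * sqrtC '[v].
Proof.
rewrite -(@ler_sqr _ _ (sqrtC '[u] * sqrtC '[v])) ?nnegrE ?mulr_ge0 ?sqrtC_ge0//.
by rewrite exprMn !sqrtCK dot_cauchy_schwarz.
Qed.

Lemma sqrt_dnormD_le u v : sqrtC '[u + v] <= sqrtC '[u] + sqrtC '[v].
Proof.
rewrite -ler_sqr ?nnegrE ?addr_ge0 ?sqrtC_ge0// sqrrD !sqrtCK dnormD addrAC lerD2r lerD2l.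
set d := '[u, v].
have dd : d + d^* \is Num.real by rewrite CrealE rmorphD/= conjCK addrC.
rewrite (le_trans (real_ler_norm dd))// (le_trans (ler_normD _ _))//.
by rewrite norm_conjC -mulr2n lerMn2r dot_cauchy_schwarz_sqrt orbT.
Qed.

Lemma sqrt_dnormZ a u : sqrtC '[a *: u] = `|a| * sqrtC '[u].
Proof. by rewrite dnormZ sqrtCM ?nnegrE ?exprn_ge0// sqrCK. Qed.

End cauchy_schwarz.

Section l2_hilbert.
Variable R : realType.
Local Notation dot := (@l2dot R : {dot l2 R for Num.conj}).

Definition l2norm (x : l2 R) : R[i] := sqrtC (l2dot x x).

Lemma l2normD x y : l2norm (x + y) <= l2norm x + l2norm y.
Proof. exact: (sqrt_dnormD_le dot). Qed.

Lemma l2normZ a x : l2norm (a *: x) = `|a| * l2norm x.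
Proof. exact: (sqrt_dnormZ dot). Qed.

Lemma l2norm_eq0 x : l2norm x = 0 -> x = 0.
Proof. by move/eqP; rewrite sqrtC_eq0 => /eqP/l2dot_eq0. Qed.

HB.instance Definition _ :=
  Lmodule_isNormed.Build R[i] (l2 R) l2normD l2normZ l2norm_eq0.

Lemma l2_norm_sqr (x : l2 R) : `|x| ^+ 2 = l2dot x x.
Proof. exact: sqrtCK. Qed.

Lemma l2_norm_sqr_series (x : l2 R) : `|x| ^+ 2 = (limn [series sqnorm (x k)]_k)%:C.
Proof. by rewrite l2_norm_sqr l2dotxx. Qed.

End l2_hilbert.

Lemma Re_normE (R : realType) (V : normedModType R[i]) (x : V) : (Re `|x|)%:C = `|x|.
Proof. by apply: RRe_real; exact: ger0_real. Qed.

Lemma Re_norm_ge0 (R : realType) (V : normedModType R[i]) (x : V) : 0 <= Re `|x|.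
Proof. by rewrite -lecR Re_normE; exact: normr_ge0. Qed.

Lemma cvg_le_const (R : realType) (T : Type) (F : set_system T) (FF : ProperFilter F)
    (f : T -> R) (l c : R) :
  f @ F --> l -> (\forall x \near F, f x <= c) -> l <= c.
Proof. by move=> fl fc; apply: (closed_cvg (fun y => y <= c)) fl => //; exact: closed_le. Qed.

Lemma cvg_fsum (R : realType) (T : Type) (F : set_system T) (FF : Filter F) n
    (f : 'I_n -> T -> R) (l : 'I_n -> R) :
  (forall i, f i @ F --> l i) -> \sum_(i < n) f i x @[x --> F] --> \sum_(i < n) l i.
Proof. by move=> fl; apply: cvg_big => // x; exact: add_continuous. Qed.

(** * Completeness of l^2 *)

Section l2_complete.
Context {R : realType}.
Implicit Types x y : l2 R.

Lemma l2_norm_le x (e : R) : 0 <= e ->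
  (forall n, \sum_(k < n) sqnorm (x k) <= e ^+ 2) -> `|x| <= e%:C.
Proof.
move=> e0 xe; rewrite -(@ler_sqr _ _ e%:C) ?nnegrE ?lecR// l2_norm_sqr_series -rmorphXn lecR.
apply: limr_le; first exact: l2_summable.
by apply: nearW => n; rewrite /series/= big_mkord.
Qed.

Lemma sqnorm_sum_norm x n : \sum_(k < n) sqnorm (x k) <= (Re `|x|) ^+ 2.
Proof.
by rewrite -lecR rmorphXn/= Re_normE l2_norm_sqr_series lecR sqnorm_sum_le.
Qed.

Lemma sqnorm_norm x k : sqnorm (x k) <= (Re `|x|) ^+ 2.
Proof.
apply: le_trans (sqnorm_sum_norm x k.+1); rewrite big_ord_recr/= lerDr.
by apply: sumr_ge0 => i _; exact: sqnorm_ge0.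
Qed.

Lemma abs_Re_norm x k : `|Re (x k)| <= Re `|x|.
Proof.
rewrite -ler_sqr ?nnegrE ?Re_norm_ge0// real_normK ?num_real//.
by apply: le_trans (sqnorm_norm x k); rewrite lerDl sqr_ge0.
Qed.

Lemma abs_Im_norm x k : `|Im (x k)| <= Re `|x|.
Proof.
rewrite -ler_sqr ?nnegrE ?Re_norm_ge0// real_normK ?num_real//.
by apply: le_trans (sqnorm_norm x k); rewrite lerDr sqr_ge0.
Qed.

(** Coordinates are 1-Lipschitz for the norm, so each of them converges along the filter; the limits
    form a sequence [z], which remains to be shown square summable and close to the filter in
    norm. *)
Lemma l2_cauchy_cvg (F : set_system (l2 R)) : ProperFilter F -> cauchy F -> cvg F.
Proof.
move=> FF /cauchy_ballP cF.
have cF2 (e : R) : 0 < e -> \forall y & w \near F, Re `|y - w| < e.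
  move=> e0; have := cF e%:C; rewrite ltcR => /(_ e0).
  by apply: filterS => -[y w]/=; rewrite -ball_normE/= -Re_normE ltcR.
have coord (f : nat -> l2 R -> R) :
    (forall k x y, `|f k x - f k y| <= Re `|x - y|) ->
    exists l : nat -> R, forall k, f k x @[x --> F] --> l k.
  move=> fB; have h k : exists l : R, f k x @[x --> F] --> l.
    exists (lim (f k x @[x --> F])); apply: R_complete; apply/cauchy_ballP => e e0.
    rewrite near_map2; apply: filterS (cF2 e e0) => -[y w]/=.
    by apply: le_lt_trans; exact: fB.
  by have [l lP] := choice h; exists l.
have [zr zrP] := coord (fun k x => Re (x k))
  (fun k x y => ltac:(by rewrite -Re_opp -Re_add; exact: (abs_Re_norm (x - y)))).
have [zi ziP] := coord (fun k x => Im (x k))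
  (fun k x y => ltac:(by rewrite -Im_opp -Im_add; exact: (abs_Im_norm (x - y)))).
pose z k := zr k +i* zi k.
(* Finite sums of squares pass to the limit in [w] coordinate by coordinate, with a bound that does
   not depend on [n]; this replaces an exchange of limits. *)
have close (e : R) : 0 < e ->
    \forall y \near F, forall n, \sum_(k < n) sqnorm ((y : l2 R) k - z k) <= e ^+ 2.
  move=> e0; apply: filterS (nearP_dep (cF2 e e0)) => y ye n.
  apply: (@cvg_le_const R _ F _ (fun w : l2 R => \sum_(k < n) sqnorm (y k - w k))).
    apply: (@cvg_fsum _ _ F _ _ (fun k (w : l2 R) => sqnorm (y k - w k))) => k; rewrite /sqnorm.
    under eq_fun do rewrite !Re_add !Im_add !Re_opp !Im_opp !expr2.
    rewrite !Re_add !Im_add !Re_opp !Im_opp !expr2.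
    have cR : Re (y k) - Re ((w : l2 R) k) @[w --> F] --> Re (y k) - zr k.
      by apply: cvgB; [exact: cvg_cst|exact: zrP].
    have cI : Im (y k) - Im ((w : l2 R) k) @[w --> F] --> Im (y k) - zi k.
      by apply: cvgB; [exact: cvg_cst|exact: ziP].
    by apply: cvgD; apply: cvgM.
  apply: filterS ye => w yw; rewrite (le_trans (sqnorm_sum_norm (y - w) n))//.
  by rewrite ler_sqr// ?nnegrE ?Re_norm_ge0 ?ltW.
have sz : square_summable z.
  have [y yP] := filter_ex (close 1 ltr01).
  have yz : square_summable (fun k => y k - z k).
    apply: nondecreasing_is_cvgn.
      by apply/nondecreasing_seqP => m; rewrite /series/= big_nat_recr//= lerDl sqnorm_ge0.
    by exists (1 ^+ 2) => _ [n _ <-]; rewrite /series/= big_mkord.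
  (* [y] and [y - z] are square summable, so [z] is too, by closure under linear combinations. *)
  have zE : z = (-1) *: (fun k => y k - z k) + y.
    apply/funext => k; rewrite -[RHS]/(-1 * (y k - z k) + y k).
    by rewrite mulN1r opprB subrK.
  rewrite zE; apply/asboolP.
  by apply: (l2_submod_closed R).2; apply/asboolP => //; exact: l2_summable.
have /asboolP sz' := sz.
apply/cvg_ex; exists (L2 sz'); apply/cvgrPdist_le => e.
case: e => e e' /=; rewrite ltcE/= => /andP[/eqP -> e0].
apply: filterS (close e e0) => y ye; rewrite distrC.
by apply: (@l2_norm_le (y - L2 sz') e (ltW e0)) => n; exact: ye.
Qed.

HB.instance Definition _ := Uniform_isComplete.Build (l2 R) l2_cauchy_cvg.

HB.instance Definition _ := NormedModule_isHilbert.Build R (l2 R) (@l2_norm_sqr R).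

End l2_complete.

Lemma Re_normcE (R : realType) (z : R[i]) : (Re `|z|)%:C = `|z|.
Proof. exact: (Re_normE (z : R[i]^o)). Qed.

Lemma Re_normc_ge0 (R : realType) (z : R[i]) : 0 <= Re `|z|.
Proof. exact: (Re_norm_ge0 (z : R[i]^o)). Qed.

(** * Bessel's inequality and Parseval's identity *)

Section parseval.
Context {R : realType} {H : hilbertType R}.
Implicit Types (x y : H) (e : nat -> H).

Lemma innerDl x y z : inner (x + y) z = inner x z + inner y z.
Proof. exact: linearDl. Qed.
Lemma innerBl x y z : inner (x - y) z = inner x z - inner y z.
Proof. exact: linearBl. Qed.
Lemma innerZl c x z : inner (c *: x) z = c * inner x z.
Proof. exact: linearZl_LR. Qed.
Lemma inner_suml (I : Type) (r : seq I) (P : pred I) (F : I -> H) z :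
  inner (\sum_(i <- r | P i) F i) z = \sum_(i <- r | P i) inner (F i) z.
Proof. exact: linear_sumlz. Qed.
Lemma innerC x y : inner x y = Num.conj (inner y x).
Proof. by rewrite [LHS]hermC mul1r. Qed.

Lemma inner0r y : inner y 0 = 0. Proof. exact: linear0r. Qed.
Lemma innerZr c x z : inner x (c *: z) = Num.conj c * inner x z.
Proof. exact: linearZr_LR. Qed.

Lemma norm_inner x y : `|inner x y| <= `|x| * `|y|.
Proof.
have := dot_cauchy_schwarz_sqrt inner x y.
by rewrite -!normr_inner !sqrCK.
Qed.

Section orthonormal.
Variables (e : nat -> H) (e_basis : orthonormal_basis e) (x : H).
Let c n := inner x (e n).

Let inner_ec m n : inner (c m *: e m) (e n) = if m == n then c n else 0.
Proof.
have [e1 e2 _] := e_basis; rewrite innerZl; have [->|mn] := eqVneq m n; last first.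
  by rewrite e2 ?mulr0//; exact/eqP.
(* A zero vector of the family has coefficient [c n = 0], so the formula holds for it as well. *)
have [en0|en1] := e1 n; first by rewrite /c en0 inner0r mul0r.
by rewrite -normr_inner en1 expr1n mulr1.
Qed.

Let inner_sum M n : inner (\sum_(k < M) c k *: e k) (e n) = if (n < M)%N then c n else 0.
Proof.
rewrite inner_suml; under eq_bigr do rewrite inner_ec.
case: ltnP => nM.
  by rewrite (bigD1 (Ordinal nM))//= eqxx big1 ?addr0// => i /eqP/val_eqP/negPf/= ->.
by rewrite big1// => i _; case: eqP => // /esym/eqP; rewrite gtn_eqF// (leq_trans _ nM).
Qed.

Let norm_sum N M : `|\sum_(N <= k < M) c k *: e k| ^+ 2 = (\sum_(N <= k < M) sqnorm (c k))%:C.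
Proof.
have [NM|MN] := leqP N M; last by rewrite !big_geq ?(ltnW MN)// normr0 expr0n.
elim: M NM => [|M IH]; first by rewrite leqn0 => /eqP->; rewrite !big_geq// normr0 expr0n.
rewrite leq_eqVlt => /orP[/eqP->|]; first by rewrite !big_geq// normr0 expr0n.
rewrite ltnS => NM; rewrite !big_nat_recr//= normr_inner hnormDd/=; last first.
  rewrite innerZr inner_suml big_nat big1 ?mulr0// => i /andP[_ iM].
  by rewrite inner_ec ltn_eqF.
rewrite -!normr_inner IH// rmorphD/=; congr (_ + _).
rewrite normr_inner innerZr inner_ec eqxx -normCKC sqnormE.
by [].
Qed.

Lemma bessel_eq N : `|x - \sum_(k < N) c k *: e k| ^+ 2 =
  `|x| ^+ 2 - (\sum_(k < N) sqnorm (c k))%:C.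
Proof.
have o : inner (x - \sum_(k < N) c k *: e k) (\sum_(k < N) c k *: e k) = 0.
  rewrite innerC inner_suml big1 ?rmorph0// => i _.
  by rewrite innerZl innerC innerBl inner_sum ltn_ord subrr rmorph0 mulr0.
rewrite -[in RHS](subrK (\sum_(k < N) c k *: e k) x) [X in _ = X - _]normr_inner hnormDd//=.
by rewrite -!normr_inner -(big_mkord xpredT (fun k => c k *: e k)) norm_sum !big_mkord addrK.
Qed.

Lemma bessel N : \sum_(k < N) sqnorm (c k) <= (Re `|x|) ^+ 2.
Proof.
by rewrite -lecR rmorphXn/= Re_normE -subr_ge0 -bessel_eq exprn_ge0.
Qed.

(** Bessel makes the Fourier series of [x] Cauchy, so it has a sum [S]; the difference [x - S] is
    orthogonal to every [e n], hence zero by totality of the basis. [bessel_eq] then turns the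
    convergence in norm into that of the squared coefficients. *)
Lemma parseval : series (fun k => sqnorm (c k)) @ \oo --> (Re `|x|) ^+ 2.
Proof.
have cs : cvgn (series (fun k => sqnorm (c k))).
  apply: nondecreasing_is_cvgn.
    by apply/nondecreasing_seqP => m; rewrite /series/= big_nat_recr//= lerDl sqnorm_ge0.
  by exists ((Re `|x|) ^+ 2) => _ [n _ <-]; rewrite /series/= big_mkord bessel.
have /cauchy_cvg/cvg_ex[/= S sS] : cauchy (series (fun k => c k *: e k) @ \oo).
  apply/cauchy_seriesP => -[d d'] /=; rewrite ltcE/= => /andP[/eqP -> d0].
  have /cauchy_cvgP/cauchy_seriesP/(_ (d ^+ 2)) := cs.
  rewrite exprn_gt0// => /(_ isT); apply: filterS => -[N M]/=.
  rewrite ger0_norm ?sumr_ge0// => [|i _]; last exact: sqnorm_ge0.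
  move=> lt_d2; rewrite -ltr_sqr ?nnegrE//; last by rewrite ler0c ltW.
  by rewrite norm_sum -[X in _ < X ^+ 2]/(d%:C) -rmorphXn/= ltcR.
have sS' (d : R) : 0 < d -> \forall N \near \oo, Re `|S - \sum_(k < N) c k *: e k| <= d.
  move=> d0; have /cvgrPdist_le/(_ d%:C) := sS; rewrite ltcR => /(_ d0).
  by apply: filterS => N; rewrite /series/= big_mkord -Re_normE lecR.
have xS : x = S.
  apply/eqP; rewrite -subr_eq0; apply/eqP; have [e1 _ e3] := e_basis; apply: e3 => n.
  apply/eqP; rewrite -normr_eq0 -Re_normcE eq_complex eqxx andbT/= eq_le Re_normc_ge0 andbT.
  apply/ler_addgt0Pl => d d0; rewrite addr0.
  (* Once [N > n], the vector [x] minus its N-th partial sum is orthogonal to [e n], so only the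
     distance from that partial sum to [S] contributes. *)
  have [N [SN nN]] : exists N, Re `|S - \sum_(k < N) c k *: e k| <= d /\ (n < N)%N.
    by near \oo => N; exists N; split; near: N; [exact: sS'|exact: nbhs_infty_gt].
  rewrite -lecR Re_normcE -[x](subrK (\sum_(k < N) c k *: e k)) -addrA innerDl.
  rewrite innerBl inner_sum nN subrr add0r (le_trans (norm_inner _ _))//.
  have h : `|\sum_(k < N) c k *: e k - S| <= d%:C by rewrite distrC -Re_normE lecR.
  have h1 : `|e n| <= 1 by case: (e1 n) => ->; rewrite ?normr0.
  by rewrite -[leRHS]mulr1; apply: ler_pM.
apply/cvgrPdist_le => d d0.
have := sS' (Num.sqrt d); rewrite sqrtr_gt0 => /(_ d0); apply: filterS => N.
rewrite -xS => xN; rewrite -lecR; apply: (@le_trans _ _ (`|x - \sum_(k < N) c k *: e k| ^+ 2)).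
  rewrite bessel_eq ger0_norm ?subr_ge0; last by rewrite /series/= big_mkord bessel.
  by rewrite /series/= big_mkord rmorphB/= rmorphXn/= Re_normE.
rewrite -Re_normE -rmorphXn lecR -(sqr_sqrtr (ltW d0)) ler_sqr// nnegrE.
  exact: Re_norm_ge0.
exact: sqrtr_ge0.
Unshelve. all: by end_near. Qed.

End orthonormal.
End parseval.

Section complex_limits.
Context {R : realType}.
Implicit Types z w : R[i].

Definition cabs z : R := Re `|z|.

Lemma cabsE z : (cabs z)%:C = `|z|. Proof. exact: Re_normcE. Qed.
Lemma cabs_ge0 z : 0 <= cabs z. Proof. exact: Re_normc_ge0. Qed.
Lemma cabs_sqr z : cabs z ^+ 2 = sqnorm z.
Proof. by apply: complexI; rewrite rmorphXn/= cabsE -sqnormE. Qed.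
Lemma cabsM z w : cabs (z * w) = cabs z * cabs w.
Proof. by apply: complexI; rewrite rmorphM/= !cabsE normrM. Qed.
Lemma cabsN z : cabs (- z) = cabs z.
Proof. by rewrite /cabs normrN. Qed.
Lemma cabsD z w : cabs (z + w) <= cabs z + cabs w.
Proof. by rewrite -lecR rmorphD/= !cabsE ler_normD. Qed.
Lemma cabs_real (x : R) : cabs x%:C = `|x|.
Proof.
apply/eqP; rewrite -(@eqrXn2 _ 2)// ?cabs_ge0// cabs_sqr /sqnorm/= expr0n addr0.
by rewrite real_normK ?num_real.
Qed.
Lemma abs_Re_cabs z : `|Re z| <= cabs z.
Proof.
rewrite -ler_sqr ?nnegrE ?cabs_ge0// cabs_sqr real_normK ?num_real//.
by rewrite lerDl sqr_ge0.
Qed.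
Lemma abs_Im_cabs z : `|Im z| <= cabs z.
Proof.
rewrite -ler_sqr ?nnegrE ?cabs_ge0// cabs_sqr real_normK ?num_real//.
by rewrite lerDr sqr_ge0.
Qed.
Lemma cabs_le_ReIm z : cabs z <= `|Re z| + `|Im z|.
Proof.
rewrite -ler_sqr ?nnegrE ?cabs_ge0 ?addr_ge0// cabs_sqr sqrrD !real_normK ?num_real//.
by rewrite /sqnorm -addrA lerD2l lerDr mulrn_wge0// mulr_ge0.
Qed.

Lemma cvg_complexP (T : Type) (F : set_system T) (FF : Filter F) (u : T -> R[i]^o) z :
  (forall e : R, 0 < e -> \forall x \near F, cabs (z - u x) <= e) -> u @ F --> (z : R[i]^o).
Proof.
move=> uz; apply/cvgrPdist_le => -[d d']; rewrite ltcE/= => /andP[/eqP -> d0].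
by apply: filterS (uz d d0) => x ux; rewrite -[`|_|]Re_normcE lecR.
Qed.

Lemma cvg_Re_Im (T : Type) (F : set_system T) (FF : Filter F) (u : T -> R[i]^o) a b :
  Re (u x) @[x --> F] --> a -> Im (u x) @[x --> F] --> b -> u @ F --> (a +i* b : R[i]^o).
Proof.
move=> /cvgrPdist_le ua /cvgrPdist_le ub; apply: cvg_complexP => e e0.
apply: filterS2 (ua _ (divr_gt0 e0 (ltr0Sn _ 1))) (ub _ (divr_gt0 e0 (ltr0Sn _ 1))).
move=> x h1 h2; rewrite [leRHS]splitr (le_trans (cabs_le_ReIm _))//.
by rewrite Re_add Im_add Re_opp Im_opp/= lerD.
Qed.

Lemma cvg_csum (u : nat -> R[i]) : csummable u ->
  series (u : nat -> R[i]^o) @ \oo --> (csum u : R[i]^o).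
Proof.
move=> su; apply: cvg_Re_Im.
  by under eq_fun do rewrite /series/= Re_sum; exact: csummable_Re.
by under eq_fun do rewrite /series/= Im_sum; exact: csummable_Im.
Qed.

Lemma eq_csum (u v : nat -> R[i]) : u =1 v -> csum u = csum v.
Proof. by move=> /funext ->. Qed.

Lemma csummable_cabs (u : nat -> R[i]) : cvgn [series cabs (u k)]_k -> csummable u.
Proof. by move=> cu; apply: csummableP cu => n; [exact: abs_Re_cabs|exact: abs_Im_cabs]. Qed.

End complex_limits.

(** * Exchange of two summations *)

Section tannery.
Context {R : realType}.
Variables (a : R^nat) (w : nat -> nat -> R).
Hypotheses (ca : cvgn [series `|a k|]_k) (w_ge0 : forall n k, 0 <= w n k)
  (w_le1 : forall N k, \sum_(n < N) w n k <= 1)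
  (cw : forall k, \sum_(n < N) w n k @[N --> \oo] --> (1 : R)).

Let cvg_weighted (v : R^nat) : (forall k, 0 <= v k <= 1) -> cvgn (series (fun k => a k * v k)).
Proof.
move=> v01; apply: normed_cvg; apply: series_abs_cvg ca => k.
by have /andP[v0 v1] := v01 k; rewrite normrM (ger0_norm v0) ler_piMr.
Qed.

(** The N-th partial sum over n is the sum of [a k] weighted by [W k], the sum of the [w n k] with
    [n < N], which lies in [[0, 1]] and tends to 1. The error is thus a sum of [a k * (1 - W k)]: up
    to a fixed [K] it is a finite sum tending to 0, and beyond [K] it is at most the tail of the
    [|a k|]. *)
Lemma tannery : series (fun n => limn (series (fun k => a k * w n k))) @ \oo -->
  limn (series a).
Proof.
have W01 N k : 0 <= \sum_(n < N) w n k <= 1 by rewrite w_le1 sumr_ge0.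
have w01 n k : 0 <= w n k <= 1.
  by rewrite w_ge0 (le_trans _ (w_le1 n.+1 k))// big_ord_recr/= lerDr sumr_ge0.
have sE N : series (fun n => limn (series (fun k => a k * w n k))) N =
    limn (series (fun k => a k * \sum_(n < N) w n k)).
  elim: N => [|N IH].
    rewrite /series/= big_geq//; under [X in limn X]eq_fun do
      (under eq_bigr do rewrite big_ord0 mulr0; rewrite big1//).
    by rewrite lim_cst.
  rewrite seriesSr IH -limn_seriesD//; [|exact: cvg_weighted..].
  by congr (limn (series _)); apply/funext => k; rewrite big_ord_recr/= mulrDr.
have ca' : cvgn (series a) by exact: normed_cvg.
apply/cvgrPdist_le => e e0.
have e20 : 0 < e / 2 by rewrite divr_gt0.
have [K tailK] : exists K, forall m, \sum_(K <= k < m) `|a k| <= e / 2.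
  have := ca => /cvg_ex[/= L cL]; have cL' := cvg_lim (@Rhausdorff R) cL.
  have nd : nondecreasing_seq [series `|a k|]_k.
    by apply/nondecreasing_seqP => m; rewrite /series/= big_nat_recr//= lerDl.
  have /cvgrPdist_le/(_ _ e20)[K _ /(_ K (leqnn _))/=] := cL.
  move=> LK; exists K => m; have [Km|mK] := leqP K m; last first.
    by rewrite big_geq ?ltW// ltnW.
  apply: le_trans LK; rewrite (le_trans _ (ler_norm _))// lerBrDl.
  rewrite /series/= -big_cat_nat//= -cL'.
  exact: (nondecreasing_cvgn_le nd ca m).
have headK : \sum_(k < K) `|a k| * (1 - \sum_(n < N) w n k) @[N --> \oo] --> (0 : R).
  rewrite [X in _ --> X](_ : _ = \sum_(k < K) `|a k| * (1 - 1)); last first.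
    by rewrite big1// => k _; rewrite subrr mulr0.
  apply: (@cvg_fsum _ _ _ _ _ (fun k N => `|a k| * (1 - \sum_(n < N) w n k))) => k.
  by apply: cvgM; [exact: cvg_cst|apply: cvgB; [exact: cvg_cst|exact: cw]].
move/cvgrPdist_le : headK => /(_ _ e20); apply: filterS => N; rewrite sub0r normrN => hN.
rewrite sE.
have W01' k : 0 <= 1 - \sum_(n < N) w n k <= 1.
  by have /andP[W0 W1] := W01 N k; rewrite subr_ge0 W1 gerBl.
have cW := cvg_weighted W01'.
have -> : limn (series a) - limn (series (fun k => a k * \sum_(n < N) w n k)) =
    limn (series (fun k => a k * (1 - \sum_(n < N) w n k))).
  have -> : series (fun k => a k * (1 - \sum_(n < N) w n k)) =
      series a - series (fun k => a k * \sum_(n < N) w n k).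
    apply/funext => m; rewrite /series/= -[RHS]sumrB.
    by apply: eq_bigr => k _; rewrite mulrBr mulr1.
  by rewrite limB//; exact: cvg_weighted (W01 N).
have /cvg_norm cW' := cW.
apply: (cvg_le_const _ cW'); apply: nearW => m /=.
rewrite [leRHS]splitr (le_trans (ler_norm_sum _ _ _))//.
under eq_bigr => k _ do rewrite normrM (ger0_norm (proj1 (andP (W01' k)))).
have ge0 k : 0 <= `|a k| * (1 - \sum_(n < N) w n k).
  by rewrite mulr_ge0//; case/andP: (W01' k).
apply: (@le_trans _ _ (\sum_(0 <= k < maxn K m) `|a k| * (1 - \sum_(n < N) w n k))).
  rewrite (@big_cat_nat _ _ _ m 0 (maxn K m))//= ?leq_maxr// lerDl.
  by apply: sumr_ge0.
rewrite (@big_cat_nat _ _ _ K 0 (maxn K m))//= ?leq_maxl// lerD//.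
  by rewrite big_mkord (le_trans (ler_norm _)).
apply: le_trans (tailK (maxn K m)); apply: ler_sum => k _.
by rewrite ler_piMr//; case/andP: (W01' k).
Qed.

End tannery.

(** * Diagonal operators *)

Section operator_norm.
Context {R : realType} {H : hilbertType R}.
Implicit Types (T : H -> H) (x : H).

Lemma le_opnorm T x : `|x| <= 1 -> ((Re `|T x|)%:E <= opnorm T)%E.
Proof. by move=> x1; apply: ereal_sup_ubound; exists x. Qed.

Lemma opnorm_le T (M : R) : (forall x, `|x| <= 1 -> Re `|T x| <= M) -> (opnorm T <= M%:E)%E.
Proof. by move=> TM; apply: ge_ereal_sup => _ [x /= x1 <-]; rewrite lee_fin TM. Qed.

Lemma opnorm_ge0 T : (0 <= opnorm T)%E.
Proof.
apply: le_trans (@le_opnorm T 0 _); first by rewrite lee_fin Re_norm_ge0.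
by rewrite normr0.
Qed.

Lemma Re_norm_le_fine_opnorm T x : (opnorm T < +oo)%E -> `|x| <= 1 ->
  Re `|T x| <= fine (opnorm T).
Proof.
move=> Toy x1; rewrite -lee_fin fineK ?le_opnorm//.
by rewrite ge0_fin_numE// opnorm_ge0.
Qed.

End operator_norm.

(** * The standard basis of l^2 *)

Section standard_basis.
Context {R : realType}.

Definition delta (n k : nat) : R[i] := (k == n)%:R.

Lemma delta_sqnorm_sum n m : \sum_(k < m) sqnorm (delta n k) = (n < m)%:R.
Proof.
have E k : sqnorm (delta n k) = (k == n)%:R.
  by rewrite /delta; case: eqP => _; rewrite /sqnorm/= ?expr1n ?expr0n/= ?addr0.
under eq_bigr do rewrite E.
case: ltnP => nm.
  by rewrite (bigD1 (Ordinal nm))//= eqxx big1 ?addr0// => i /eqP/val_eqP/negPf/= ->.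
by rewrite big1// => i _; rewrite ltn_eqF// (leq_trans _ nm).
Qed.

Lemma delta_series n : series (fun k => sqnorm (delta n k)) @ \oo --> (1 : R).
Proof.
apply: cvg_near_cst; near=> m; rewrite /series/= big_mkord delta_sqnorm_sum.
by rewrite (_ : (n < m)%N)//; near: m; exact: nbhs_infty_gt.
Unshelve. all: by end_near. Qed.

Fact delta_l2 n : delta n \in @l2_pred R.
Proof. by apply/asboolP/cvgP; exact: delta_series. Qed.

Definition std n : l2 R := L2 (delta_l2 n).

Lemma stdE n k : std n k = (k == n)%:R. Proof. by []. Qed.

Lemma norm_std n : `|std n| = 1.
Proof.
apply/eqP; rewrite -(@eqrXn2 _ 2)// expr1n l2_norm_sqr_series.
by apply/eqP; rewrite (cvg_lim _ (@delta_series n))//.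
Qed.

Lemma csum_single (u : nat -> R[i]) n : (forall k, k != n -> u k = 0) -> csum u = u n.
Proof.
move=> un.
have E m : (n < m)%N -> \sum_(k < m) u k = u n.
  by move=> nm; rewrite (bigD1 (Ordinal nm))//= big1 ?addr0// => i /eqP/val_eqP/un.
apply/eqP; rewrite eq_complex /csum/=; apply/andP; split; apply/eqP; apply: cvg_lim => //;
  apply: cvg_near_cst; near=> m; rewrite /series/= big_mkord -?Re_sum -?Im_sum E//;
  by near: m; exact: nbhs_infty_gt.
Unshelve. all: by end_near. Qed.

Lemma innerE (x y : l2 R) : inner x y = csum (fun k => x k * Num.conj (y k)).
Proof. by []. Qed.

Lemma inner_std (x : l2 R) n : inner x (std n) = x n.
Proof.
rewrite innerE (@csum_single _ n) => [|k /negPf kn]; rewrite stdE ?eqxx ?kn ?rmorph1 ?mulr1//.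
by rewrite rmorph0 mulr0.
Qed.

Lemma std_basis : orthonormal_basis std.
Proof.
split=> [n|m n /eqP mn|x xn]; first by right; exact: norm_std.
  by rewrite inner_std stdE eq_sym (negPf mn).
by apply: l2_ext => k; rewrite -inner_std xn.
Qed.

End standard_basis.

Lemma nneseries_EFin (R : realType) (u : R^nat) : cvgn (series u) ->
  (\sum_(0 <= n <oo) (u n)%:E)%E = (limn (series u))%:E.
Proof.
move=> cu; rewrite -EFin_lim// (_ : (fun n : nat => _) = EFin \o series u)//.
by apply/funext => n; rewrite /= sumEFin.
Qed.

Lemma conjM (R : realType) (z w : R[i]) : Num.conj (z * w) = Num.conj z * Num.conj w.
Proof. by case: z w => [a b] [c d]; rewrite /Num.conj/=; congr (_ +i* _); ring. Qed.

Lemma conj_realM (R : realType) (t : R) (z : R[i]) :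
  Num.conj (t%:C * z) = t%:C * Num.conj z.
Proof. by rewrite conjM; congr (_ * _); exact: conjc_real. Qed.

(** This is [|z|^2 = z * conj z] inside an inner product; entry by entry it shows that [diag] of the
    moduli is the absolute value of [diag c]. *)
Lemma cabs_polar (R : realType) (z x y : R[i]) :
  (cabs z)%:C * x * Num.conj ((cabs z)%:C * y) = z * x * Num.conj (z * y).
Proof.
have E : (cabs z)%:C * (cabs z)%:C = z * Num.conj z by rewrite cabsE -expr2 normCK.
rewrite conj_realM conjM; set w := Num.conj y; set v := Num.conj z in E *.
by rewrite mulrACA E mulrACA.
Qed.

Section diagonal.
Context {R : realType}.
Implicit Types (c d : nat -> R[i]) (x y : l2 R).

Definition bounded_by c (M : R) : Prop := forall k, cabs (c k) <= M.

Lemma bounded_by_ge0 c M : bounded_by c M -> 0 <= M.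
Proof. by move=> /(_ 0); apply: le_trans; exact: cabs_ge0. Qed.

(* Meaningful for bounded c only; [diag c x] is 0 if c x is not in l2. *)
Definition diag c x : l2 R :=
  if pselect ((fun k => c k * x k) \in @l2_pred R) is left cx then L2 cx else 0.

Lemma diag_l2 c M x : bounded_by c M -> (fun k => c k * x k) \in @l2_pred R.
Proof.
move=> cM; have M0 := bounded_by_ge0 cM; apply/asboolP.
apply: (series_le_cvg (v_ := fun k => M ^+ 2 * sqnorm (x k))).
- by move=> n; exact: sqnorm_ge0.
- by move=> n; rewrite mulr_ge0 ?sqr_ge0 ?sqnorm_ge0.
- by move=> n /=; rewrite sqnormM ler_wpM2r ?sqnorm_ge0// -cabs_sqr ler_sqr ?nnegrE ?cabs_ge0.
- by apply: cvg_seriesZ; exact: l2_summable.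
Qed.

Lemma diagE c M x k : bounded_by c M -> diag c x k = c k * x k.
Proof. by move=> /(@diag_l2 _ _ x) cx; rewrite /diag; case: pselect. Qed.

Lemma diag_linear c M : bounded_by c M -> linear (diag c).
Proof.
by move=> cM a x y; apply: l2_ext => k; rewrite l2D l2Z !(diagE _ _ cM) l2D l2Z mulrDr mulrCA.
Qed.

Lemma norm_diag c M x : bounded_by c M -> Re `|diag c x| <= M * Re `|x|.
Proof.
move=> cM; have M0 := bounded_by_ge0 cM; rewrite -lecR Re_normE.
apply: l2_norm_le => [|n]; first by rewrite mulr_ge0// Re_norm_ge0.
rewrite exprMn; apply: le_trans (_ : M ^+ 2 * \sum_(k < n) sqnorm (x k) <= _).
  rewrite mulr_sumr; apply: ler_sum => k _; rewrite (diagE _ _ cM) sqnormM.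
  by rewrite ler_wpM2r ?sqnorm_ge0// -cabs_sqr ler_sqr ?nnegrE ?cabs_ge0.
by rewrite ler_wpM2l ?sqr_ge0// sqnorm_sum_norm.
Qed.

Lemma opnorm_diag c M : bounded_by c M -> (opnorm (diag c) <= M%:E)%E.
Proof.
move=> cM; have M0 := bounded_by_ge0 cM; apply: opnorm_le => x x1.
rewrite (le_trans (norm_diag x cM))// ler_piMr//.
by rewrite -lecR Re_normE.
Qed.

Lemma diag_bounded c M : bounded_by c M -> bounded_op (diag c).
Proof.
by move=> cM; split; [exact: diag_linear cM|exact: le_lt_trans (opnorm_diag cM) (ltry _)].
Qed.

Lemma diag_std c M n : bounded_by c M -> diag c (std n) = c n *: std n.
Proof.
move=> cM; apply: l2_ext => k; rewrite (diagE _ _ cM) l2Z stdE.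
by case: eqVneq => [->//|_]; rewrite !mulr0.
Qed.

Lemma norm_diag_std c M n : bounded_by c M -> Re `|diag c (std n)| = cabs (c n).
Proof. by move=> cM; rewrite (diag_std _ cM) normrZ norm_std mulr1. Qed.

Lemma cabs_le_opnorm c M n : bounded_by c M -> cabs (c n) <= fine (opnorm (diag c)).
Proof.
move=> cM; rewrite -(norm_diag_std n cM) Re_norm_le_fine_opnorm ?norm_std//.
exact: (diag_bounded cM).2.
Qed.

Lemma inner_diag_std c M n : bounded_by c M -> inner (diag c (std n)) (std n) = c n.
Proof. by move=> cM; rewrite inner_std (diagE _ _ cM) stdE eqxx mulr1. Qed.

Lemma diag_self_adjoint (a : R^nat) M : (forall k, `|a k| <= M) ->
  self_adjoint (diag (fun k => (a k)%:C)).
Proof.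
move=> aM; have cM : bounded_by (fun k => (a k)%:C) M by move=> k; rewrite cabs_real.
move=> x y; rewrite !innerE; apply: eq_csum => k; rewrite !(diagE _ _ cM).
by rewrite conj_realM mulrA [x k * _]mulrC.
Qed.

Lemma inner_diag c M x : bounded_by c M ->
  inner (diag c x) x = csum (fun k => c k * (sqnorm (x k))%:C).
Proof.
move=> cM; rewrite innerE; apply: eq_csum => k.
by rewrite (diagE _ _ cM) -mulrA sqnormE normCK.
Qed.

Lemma diag_positive c M : bounded_by c M -> (forall k, 0 <= c k) -> positive_op (diag c).
Proof.
move=> cM c0; split; first exact: diag_bounded cM.
move=> x; rewrite (inner_diag _ cM).
have ck k : c k * (sqnorm (x k))%:C = (Re (c k) * sqnorm (x k))%:C.
  by rewrite rmorphM/= RRe_real// ger0_real.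
have Rc0 k : 0 <= Re (c k) by have := c0 k; rewrite lecE/= => /andP[].
have e0 (u : R^nat) : csum (fun k => (u k)%:C) = (limn (series u))%:C.
  rewrite /csum; congr (_ +i* _).
  by rewrite (_ : series _ = cst 0) ?lim_cst//; apply/funext => n; rewrite /series/= big1.
rewrite (eq_csum ck) e0 lecR; apply: limr_ge.
  apply: (series_le_cvg (v_ := fun k => M * sqnorm (x k))).
  - by move=> n; rewrite mulr_ge0 ?sqnorm_ge0.
  - by move=> n; rewrite mulr_ge0 ?sqnorm_ge0// (bounded_by_ge0 cM).
  - move=> n; rewrite ler_wpM2r ?sqnorm_ge0//.
    by rewrite (le_trans (ler_norm _))// (le_trans (abs_Re_cabs _)).
  - by apply: cvg_seriesZ; exact: l2_summable.
by apply: nearW => n; rewrite /series/= sumr_ge0// => k _; rewrite mulr_ge0 ?sqnorm_ge0.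
Qed.

Lemma diag_hilbert_schmidt c M : bounded_by c M -> cvgn [series cabs (c k) ^+ 2]_k ->
  hilbert_schmidt (diag c).
Proof.
move=> cM cs; split; first exact: diag_bounded cM.
exists std; first exact: std_basis.
under eq_eseriesr do rewrite (norm_diag_std _ cM).
by rewrite nneseries_EFin// ltry.
Qed.

Lemma summable_bounded c : cvgn [series cabs (c k)]_k -> exists M, bounded_by c M.
Proof.
move=> cs; exists (limn [series cabs (c k)]_k) => k.
have nd : nondecreasing_seq [series cabs (c k)]_k.
  by apply/nondecreasing_seqP => m; rewrite /series/= big_nat_recr//= lerDl cabs_ge0.
apply: le_trans (nondecreasing_cvgn_le nd cs k.+1).
by rewrite /series/= big_nat_recr//= lerDr sumr_ge0// => i _; exact: cabs_ge0.
Qed.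

Lemma diag_trace_class c : cvgn [series cabs (c k)]_k -> trace_class (diag c).
Proof.
move=> cs; have [M cM] := summable_bounded cs; split; first exact: diag_bounded cM.
have [d dE] : exists d : nat -> R[i], forall k, d k = (cabs (c k))%:C by eexists.
have dM : bounded_by d M by move=> k; rewrite dE cabs_real ger0_norm ?cabs_ge0.
exists (diag d).
  split; first by apply: diag_positive dM _ => k; rewrite dE ler0c cabs_ge0.
  move=> x y; rewrite !innerE; apply: eq_csum => k.
  rewrite (diagE _ _ cM) (diagE _ _ cM) (diagE _ _ dM) (diagE _ _ dM) dE; exact: cabs_polar.
exists std; first exact: std_basis.
under eq_eseriesr do rewrite (inner_diag_std _ dM) dE.
by rewrite nneseries_EFin//= ltry.
Qed.

(** The n-th entry in the basis [e] is the sum over k of [c k * sqnorm (e n k)]. Parseval for the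
    vector [std k] in the basis [e] says that these weights sum to 1 over n, which is what [tannery]
    asks for. *)
Lemma diag_trace c : cvgn [series cabs (c k)]_k -> is_trace (diag c) (csum c).
Proof.
move=> cs e e_basis; have [M cM] := summable_bounded cs.
have sc := csummable_cabs cs.
have we n k : sqnorm (e n k) = sqnorm (inner (std k) (e n)).
  by rewrite innerC sqnormJ inner_std.
have w0 n k : 0 <= sqnorm (e n k) by exact: sqnorm_ge0.
have nstd k : (Re `|std k : l2 R|) ^+ 2 = 1 by rewrite norm_std expr1n.
have w1 N k : \sum_(n < N) sqnorm (e n k) <= 1.
  by under eq_bigr do rewrite we; rewrite -(nstd k) bessel.
have cw k : \sum_(n < N) sqnorm (e n k) @[N --> \oo] --> (1 : R).
  rewrite -(nstd k); under eq_fun do (under eq_bigr do rewrite we).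
  by under eq_fun do rewrite -(big_mkord xpredT (fun n => sqnorm (inner (std k) (e n))));
    exact: parseval.
apply: cvg_Re_Im.
  have -> : (fun N => Re (series (fun n => inner (diag c (e n)) (e n)) N)) =
      series (fun n => limn (series (fun k => Re (c k) * sqnorm (e n k)))).
    apply/funext => N; rewrite /series/= Re_sum; apply: eq_bigr => n _.
    rewrite (inner_diag _ cM) /csum/=; congr (limn (series _)); apply/funext => k.
    by rewrite Re_mul/= mulr0 subr0.
  exact: (@tannery _ (fun k => Re (c k)) _ sc.1 w0 w1 cw).
have -> : (fun N => Im (series (fun n => inner (diag c (e n)) (e n)) N)) =
    series (fun n => limn (series (fun k => Im (c k) * sqnorm (e n k)))).
  apply/funext => N; rewrite /series/= Im_sum; apply: eq_bigr => n _.
  rewrite (inner_diag _ cM) /csum/=; congr (limn (series _)); apply/funext => k.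
  by rewrite Im_mul/= mulr0 add0r.
exact: (@tannery _ (fun k => Im (c k)) _ sc.2 w0 w1 cw).
Qed.

End diagonal.

(** * Weierstrass approximation *)

Section bernstein.
Context {R : realType}.
Implicit Types (phi psi : nat -> R) (x : R).

(** The usual Bernstein polynomial, as the mean of [phi] of the number of successes in n trials of
    probability x, computed by conditioning on one trial; inductions on [n] then go through without
    binomial coefficients. *)
Fixpoint bernstein n phi : {poly R} :=
  if n is m.+1 then (1 - 'X) * bernstein m phi + 'X * bernstein m (phi \o S)
  else (phi 0)%:P.

Lemma bernsteinS n phi x : (bernstein n.+1 phi).[x] =
  (1 - x) * (bernstein n phi).[x] + x * (bernstein n (phi \o S)).[x].
Proof. by rewrite /= hornerD !hornerM hornerD hornerN hornerC !hornerX. Qed.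

Lemma ler_bernstein n phi psi x : 0 <= x <= 1 ->
  (forall k, (k <= n)%N -> phi k <= psi k) ->
  (bernstein n phi).[x] <= (bernstein n psi).[x].
Proof.
move=> /andP[x0 x1]; elim: n phi psi => [|n IH] phi psi pp; first by rewrite !hornerC pp.
rewrite !bernsteinS lerD// ler_wpM2l ?subr_ge0// IH// => k kn; last exact: pp.
by rewrite pp// leqW.
Qed.

(* The mean of a + b (k - c)^2 under the binomial law with parameters n and x. *)
Lemma bernstein_quadratic n (a b c : R) x :
  (bernstein n (fun k => a + b * (k%:R - c) ^+ 2)).[x] =
  a + b * ((n%:R * x - c) ^+ 2 + n%:R * x * (1 - x)).
Proof.
elim: n c => [|n IH] c; first by rewrite hornerC; ring.
have E : (fun k => a + b * (k%:R - c) ^+ 2) \o S =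
    (fun k => a + b * (k%:R - (c - 1)) ^+ 2).
  by apply/funext => k /=; rewrite -natr1; ring.
by rewrite bernsteinS E !IH -natr1; ring.
Qed.

(** With [t = |k/n - x|], the Lipschitz bound [K * t] is at most [K * (d + t^2 / d)], which is
    quadratic in k. The mean of a quadratic is explicit, and the binomial variance [n x (1 - x)] is
    at most n. The free parameter [d] spares square roots. *)
Lemma bernstein_approx n (f : R -> R) K d x : (0 < n)%N -> 0 <= K -> 0 < d ->
  (forall x y, 0 <= x <= 1 -> 0 <= y <= 1 -> `|f x - f y| <= K * `|x - y|) ->
  0 <= x <= 1 ->
  `|(bernstein n (fun k => f (k%:R / n%:R))).[x] - f x| <= K * d + K / (d * n%:R).
Proof.
move=> n0 K0 d0 fK x01; have n0' : 0 < n%:R :> R by rewrite ltr0n.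
have fE k : (k <= n)%N ->
    `|f (k%:R / n%:R) - f x| <= K * d + K / (d * n%:R ^+ 2) * (k%:R - n%:R * x) ^+ 2.
  move=> kn; apply: le_trans (fK _ _ _ x01) _.
    by rewrite divr_ge0//= ler_pdivrMr// mul1r ler_nat.
  rewrite (_ : K / _ * _ = K * ((k%:R / n%:R - x) ^+ 2 / d)); last first.
    by field; rewrite !gt_eqF.
  rewrite -mulrDr ler_wpM2l// -[X in X / d]real_normK ?num_real//.
  set t := `|_ - x|; have t0 : 0 <= t by exact: normr_ge0.
  rewrite -(ler_pM2r d0) mulrDl divfK ?gt_eqF//.
  by have := sqr_ge0 (t - d); nra.
have xx : n%:R * x * (1 - x) <= n%:R.
  by case/andP: x01 => x0 x1; rewrite -mulrA ler_piMr//; nra.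
have B : K / (d * n%:R ^+ 2) * (n%:R * x * (1 - x)) <= K / (d * n%:R).
  apply: le_trans (_ : K / (d * n%:R ^+ 2) * n%:R <= _).
    by rewrite ler_wpM2l// divr_ge0// mulr_ge0 ?sqr_ge0 ?ltW.
  by rewrite le_eqVlt; apply/orP; left; apply/eqP; field; rewrite !gt_eqF.
rewrite ler_norml; apply/andP; split.
  rewrite lerBrDr; apply: le_trans (ler_bernstein x01 (phi := fun k =>
    (f x - K * d) + (- (K / (d * n%:R ^+ 2))) * (k%:R - n%:R * x) ^+ 2) _).
    rewrite bernstein_quadratic subrr expr0n/= add0r mulNr.
    by rewrite opprD addrC addrA lerB// lerBlDr addrC lerBrDl subrK.
  move=> k kn; have := fE k kn; rewrite ler_norml => /andP[+ _]; rewrite lerBrDr.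
  by apply: le_trans; rewrite le_eqVlt; apply/orP; left; apply/eqP; ring.
rewrite lerBlDr; apply: le_trans (ler_bernstein x01 (psi := fun k =>
  (f x + K * d) + (K / (d * n%:R ^+ 2)) * (k%:R - n%:R * x) ^+ 2) _) _.
  move=> k kn; have := fE k kn; rewrite ler_norml => /andP[_]; rewrite lerBlDr.
  by move=> /le_trans; apply; rewrite le_eqVlt; apply/orP; left; apply/eqP; ring.
rewrite bernstein_quadratic subrr expr0n/= add0r.
by rewrite [f x + _]addrC addrAC lerD2r lerD2l.
Qed.

End bernstein.

(** * Lipschitz and Taylor bounds for smooth functions *)

Section smooth_functions.
Context {R : realType}.
Implicit Types f : R -> R.

Lemma smooth_derive f : smooth f -> smooth (derive1 f).
Proof. by move=> sf n x; rewrite -derive1Sn; exact: sf. Qed.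

Lemma smooth_derivable f x : smooth f -> derivable f x 1.
Proof. by move=> /(_ 0 x). Qed.

Lemma smooth_continuous f : smooth f -> continuous f.
Proof.
by move=> sf x; apply/differentiable_continuous/derivable1_diffP/smooth_derivable.
Qed.

Lemma smooth_is_derive f x : smooth f -> is_derive (x : R) (1 : R) f (derive1 f x).
Proof. by move=> sf; rewrite derive1E; apply/derivableP/smooth_derivable. Qed.

Lemma smooth_mvt f x y : smooth f -> x <= y ->
  exists2 z, x <= z <= y & f y - f x = derive1 f z * (y - x).
Proof.
move=> sf xy; have [z|z|z zxy E] := @MVT_segment R f (derive1 f) x y xy.
- by move=> _; exact: smooth_is_derive.
- exact/continuous_subspaceT/smooth_continuous.
- by exists z => //; rewrite in_itv/= in zxy.
Qed.

Lemma smooth_bounded f M : smooth f -> exists2 K, 0 <= K & forall x, `|x| <= M -> `|f x| <= K.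
Proof.
move=> sf; have [M0|M0] := leP 0 M; last first.
  by exists 0 => // x xM; have := le_lt_trans (le_trans (normr_ge0 x) xM) M0; rewrite ltxx.
have c : {within `[- M, M], continuous (fun x => `|f x|)}.
  by apply: continuous_subspaceT => x; apply: cvg_norm; exact: smooth_continuous.
have MM : - M <= M by lra.
have [z zM zmax] := EVT_max MM c.
by exists `|f z| => // x; rewrite ler_norml => xM; apply: zmax; rewrite in_itv.
Qed.

Lemma smooth_lipschitz f M : smooth f ->
  exists2 K, 0 <= K & forall x y, `|x| <= M -> `|y| <= M -> `|f x - f y| <= K * `|x - y|.
Proof.
move=> sf; have [K K0 fK] := smooth_bounded M (smooth_derive sf); exists K => // x y.
wlog xy : x y / x <= y.
  move=> h xM yM; have [xy|/ltW yx] := leP x y; first exact: h.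
  by rewrite [`|f x - _|]distrC [`|x - y|]distrC h.
move=> xM yM; move: (xM) (yM); rewrite ler_norml => /andP[x1 x2].
rewrite ler_norml => /andP[y1 y2].
have [z /andP[xz zy] E] := smooth_mvt sf xy.
by rewrite [`|f x - _|]distrC E normrM [`|x - y|]distrC ler_wpM2r// fK// ler_norml; apply/andP; split; lra.
Qed.

(** The mean value theorem replaces the increment of [f] by [f' z * (a - b)], and the Lipschitz
    bound for [f'] compares [f' z] with [f' b]; the constant is that Lipschitz bound, without the
    sharp factor 1/2. *)
Lemma smooth_taylor f M : smooth f -> exists2 K, 0 <= K & forall a b,
  `|a| <= M -> `|b| <= M -> `|f a - f b - derive1 f b * (a - b)| <= K * (a - b) ^+ 2.
Proof.
move=> sf; have [K K0 fK] := smooth_lipschitz M (smooth_derive sf); exists K => // a b aM bM.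
have [z [zM zb E]] : exists z, [/\ `|z| <= M, `|z - b| <= `|a - b| &
    f a - f b = derive1 f z * (a - b)].
  move: (aM) (bM); rewrite ler_norml => /andP[a1 a2].
  rewrite ler_norml => /andP[b1 b2].
  have [ab|/ltW ba] := leP a b.
    have [z /andP[az zb] E] := smooth_mvt sf ab; exists z; split.
    - by rewrite ler_norml; apply/andP; split; lra.
    - by rewrite distrC ger0_norm ?subr_ge0// distrC ger0_norm ?subr_ge0// lerB.
    - by rewrite -opprB E -mulrN opprB.
  have [z /andP[az zb] E] := smooth_mvt sf ba; exists z; split => //.
  - by rewrite ler_norml; apply/andP; split; lra.
  - by rewrite ger0_norm ?subr_ge0// ger0_norm ?subr_ge0// lerB.
rewrite E -mulrBl normrM -[(a - b) ^+ 2]real_normK ?num_real// expr2 mulrA ler_wpM2r//.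
by rewrite (le_trans (fK _ _ zM bM))// ler_wpM2l.
Qed.

End smooth_functions.

Section weierstrass.
Context {R : realType}.

Lemma weierstrass_lipschitz (f : R -> R) K M e : 0 <= K -> 0 < e ->
  (forall x y, `|x| <= M -> `|y| <= M -> `|f x - f y| <= K * `|x - y|) ->
  exists p : {poly R}, forall x, `|x| <= M -> `|p.[x] - f x| <= e.
Proof.
move=> K0 e0 fK; wlog M0 : / 0 < M.
  move=> h; have [M0|M0] := ltP 0 M; first exact: h.
  exists (f 0)%:P => x xM; have -> : x = 0.
    by apply/eqP; rewrite -normr_le0 (le_trans xM).
  by rewrite hornerC subrr normr0 ltW.
(* [aff] carries [[0, 1]] onto [[-M, M]], and [L] is a Lipschitz constant of [f \o aff]. *)
pose aff y := M * (2 * y - 1); pose L := 2 * M * K.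
have L0 : 0 <= L by rewrite /L !mulr_ge0// ltW.
have affM y : 0 <= y <= 1 -> `|aff y| <= M.
  by move=> /andP[y0 y1]; rewrite /aff ler_norml; apply/andP; split; nra.
have fL x y : 0 <= x <= 1 -> 0 <= y <= 1 -> `|f (aff x) - f (aff y)| <= L * `|x - y|.
  move=> x01 y01; rewrite (le_trans (fK _ _ (affM _ x01) (affM _ y01)))//.
  rewrite (_ : aff x - aff y = 2 * M * (x - y)); last by rewrite /aff; ring.
  rewrite normrM ger0_norm; last by rewrite mulr_ge0// ltW.
  by rewrite /L mulrA [K * _]mulrC.
(* This [d] makes [L * d] at most [e / 2], and [n] below does the same for [L / (d * n)]; the
   summand 1 keeps the denominator positive when [L = 0]. *)
pose d := e / (2 * (L + 1)); have d0 : 0 < d by rewrite divr_gt0// mulr_gt0// ltr_wpDl.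
have q0 : 0 <= 2 * L / (d * e) by apply: divr_ge0; [exact: mulr_ge0|exact/ltW/mulr_gt0].
have [n nP] : exists n : nat, 2 * L / (d * e) < n%:R.
  exists (Num.bound (2 * L / (d * e))); exact: archi_boundP.
have n0 : (0 < n)%N.
  by rewrite -(ltr0n R) (le_lt_trans q0 nP).
(* The inner polynomial is the inverse of [aff]. *)
exists (bernstein n (fun k => f (aff (k%:R / n%:R))) \Po ((2 * M)^-1 *: 'X + 2^-1%:P)).
move=> x xM; move: (xM); rewrite ler_norml => /andP[x1 x2].
pose y := (2 * M)^-1 * x + 2^-1.
have xE : x = aff y by rewrite /aff /y; field; rewrite gt_eqF.
have y01 : 0 <= y <= 1.
  have : aff y = x by []; rewrite /aff => yx; apply/andP; split.
    by rewrite -(ler_pM2l M0); lra.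
  by rewrite -(ler_pM2l M0); lra.
rewrite horner_comp hornerD hornerZ hornerX hornerC -/y xE.
apply: le_trans (bernstein_approx (f := f \o aff) n0 L0 d0 fL y01) _.
have h1 : L * d <= e / 2.
  have : d * (2 * (L + 1)) = e by rewrite divfK// gt_eqF// mulr_gt0// ltr_wpDl.
  nra.
have h2 : L / (d * n%:R) <= e / 2.
  have nR0 : 0 < n%:R :> R by rewrite ltr0n.
  rewrite (ler_pdivrMr _ _ (mulr_gt0 d0 nR0)).
  by move: nP; rewrite (ltr_pdivrMr _ _ (mulr_gt0 d0 e0)) => /ltW; lra.
by rewrite [leRHS]splitr lerD.
Qed.

Lemma weierstrass_complex (g : R -> R[i]) M e : csmooth g -> 0 < e ->
  exists p : {poly R[i]}, forall x, `|x| <= M -> cabs (p.[x%:C] - g x) <= e.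
Proof.
move=> [gR gI] e0; have e2 : 0 < e / 2 by rewrite divr_gt0.
have [KR KR0 fR] := smooth_lipschitz M gR; have [KI KI0 fI] := smooth_lipschitz M gI.
have [p pP] := weierstrass_lipschitz KR0 e2 fR.
have [q qP] := weierstrass_lipschitz KI0 e2 fI.
exists (map_poly (real_complex R) p + 'i%C *: map_poly (real_complex R) q) => x xM.
rewrite hornerD hornerZ !horner_map [leRHS]splitr (le_trans (cabs_le_ReIm _))// lerD//.
  by rewrite Re_add Re_opp Re_add Re_mul/= mul0r mulr0 subr0 addr0 pP.
by rewrite Im_add Im_opp Im_add Im_mul/= mul0r mul1r !add0r qP.
Qed.

End weierstrass.

(** * Functional calculus and Koplienko remainder of diagonal pairs *)

Section diag_algebra.
Context {R : realType}.
Implicit Types (c d : nat -> R[i]) (x y : l2 R).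

Lemma bounded_byD c d M N : bounded_by c M -> bounded_by d N ->
  bounded_by (fun k => c k + d k) (M + N).
Proof. by move=> cM dN k; rewrite (le_trans (cabsD _ _))// lerD. Qed.

Lemma bounded_byB c d M N : bounded_by c M -> bounded_by d N ->
  bounded_by (fun k => c k - d k) (M + N).
Proof. by move=> cM dN; apply: bounded_byD => // k; rewrite cabsN. Qed.

Lemma bounded_byM c d M N : bounded_by c M -> bounded_by d N ->
  bounded_by (fun k => c k * d k) (M * N).
Proof. by move=> cM dN k; rewrite cabsM ler_pM ?cabs_ge0. Qed.

Lemma bounded_by_cst z : bounded_by (fun=> z : R[i]) (cabs z). Proof. by []. Qed.

Lemma diagD c d M N : bounded_by c M -> bounded_by d N ->
  diag c + diag d = diag (fun k => c k + d k).
Proof.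
move=> cM dN; apply/funext => x; apply: l2_ext => k.
rewrite -[(diag c + diag d) x]/(diag c x + diag d x) l2D (diagE _ _ cM) (diagE _ _ dN).
by rewrite (diagE _ _ (bounded_byD cM dN)) mulrDl.
Qed.

Lemma diagB c d M N : bounded_by c M -> bounded_by d N ->
  diag c - diag d = diag (fun k => c k - d k).
Proof.
move=> cM dN; apply/funext => x; apply: l2_ext => k.
rewrite -[(diag c - diag d) x]/(diag c x - diag d x) l2B (diagE _ _ cM) (diagE _ _ dN).
by rewrite (diagE _ _ (bounded_byB cM dN)) mulrBl.
Qed.

Lemma diagZ z c M : bounded_by c M -> z *: diag c = diag (fun k => z * c k).
Proof.
move=> cM; apply/funext => x; apply: l2_ext => k.
rewrite -[(z *: diag c) x]/(z *: diag c x) l2Z (diagE _ _ cM).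
by rewrite (diagE _ _ (bounded_byM (bounded_by_cst z) cM)) mulrA.
Qed.

Lemma l2_sum (I : Type) (r : seq I) (P : pred I) (F : I -> l2 R) k :
  (\sum_(i <- r | P i) F i) k = \sum_(i <- r | P i) F i k.
Proof. by elim/big_rec2 : _ => // i x y _; rewrite l2D => ->. Qed.

Lemma bounded_by_horner (p : {poly R[i]}) c M : bounded_by c M ->
  exists N, bounded_by (fun k => p.[c k]) N.
Proof.
move=> cM; exists (\sum_(j < size p) cabs p`_j * M ^+ j) => k; rewrite horner_coef.
have cabs_sum : cabs (\sum_(j < size p) p`_j * c k ^+ j) <=
    \sum_(j < size p) cabs (p`_j * c k ^+ j).
  elim/big_ind2 : _ => // [|x1 x2 y1 y2 h1 h2]; first by rewrite (cabs_real 0) normr0.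
  by rewrite (le_trans (cabsD _ _))// lerD.
apply: le_trans cabs_sum _; apply: ler_sum => j _; rewrite cabsM ler_wpM2l ?cabs_ge0//.
elim: (nat_of_ord j) => [|i IH]; first by rewrite !expr0 (cabs_real 1) normr1.
by rewrite !exprS cabsM ler_pM ?cabs_ge0.
Qed.

Lemma op_poly_diag (p : {poly R[i]}) c M : bounded_by c M ->
  op_poly p (diag c) = diag (fun k => p.[c k]).
Proof.
move=> cM; have [N pN] := bounded_by_horner p cM.
apply/funext => x; apply: l2_ext => k; rewrite (diagE _ _ pN) /op_poly l2_sum.
rewrite horner_coef mulr_suml; apply: eq_bigr => j _; rewrite l2Z -mulrA; congr (_ * _).
elim: (nat_of_ord j) => [|i IH]; first by rewrite mul1r.
by rewrite iterS (diagE _ _ cM) IH exprS mulrA.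
Qed.

Lemma cabs_entry_le x k : cabs (x k) <= Re `|x|.
Proof.
by rewrite -ler_sqr ?nnegrE ?cabs_ge0 ?Re_norm_ge0// cabs_sqr sqnorm_norm.
Qed.

Lemma cabs_inner_std_le (T : l2 R -> l2 R) n (e : R) : (opnorm T <= e%:E)%E ->
  cabs (inner (T (std n)) (std n)) <= e.
Proof.
move=> Te; rewrite inner_std (le_trans (cabs_entry_le _ _))// -lee_fin.
by apply: le_trans Te; apply: le_opnorm; rewrite norm_std.
Qed.

(** Shaped for two successive approximations of error [e], as in the proofs that diagonal entries
    are forced. *)
Lemma cabs_eq0_le (z w : R[i]) : (forall e : R, 0 < e -> cabs (z - w) <= e + e) -> z = w.
Proof.
move=> h; apply/eqP; rewrite -subr_eq0 -normr_eq0 -cabsE eq_complex eqxx andbT/=.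
rewrite eq_le cabs_ge0 andbT; apply/ler_addgt0Pl => e e0; rewrite addr0.
by rewrite [leRHS]splitr h ?divr_gt0.
Qed.

End diag_algebra.

Section functional_calculus.
Context {R : realType}.
Implicit Types (g : R -> R[i]) (a : R^nat) (T : l2 R -> l2 R).

Definition rdiag a : l2 R -> l2 R := diag (fun k => (a k)%:C).

Lemma bounded_by_real a M : (forall k, `|a k| <= M) -> bounded_by (fun k => (a k)%:C) M.
Proof. by move=> aM k; rewrite cabs_real. Qed.

Lemma csmooth_bounded g M : csmooth g -> exists2 K, 0 <= K & forall x, `|x| <= M -> cabs (g x) <= K.
Proof.
move=> [gR gI]; have [K K0 RK] := smooth_bounded M gR; have [L L0 IL] := smooth_bounded M gI.
exists (K + L) => [|x xM]; first exact: addr_ge0.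
by rewrite (le_trans (cabs_le_ReIm _))// lerD ?RK ?IL.
Qed.

Lemma abs_le_opnorm_rdiag a M n : (forall k, `|a k| <= M) ->
  `|a n| <= fine (opnorm (rdiag a)).
Proof. by move=> aM; rewrite -cabs_real; exact: cabs_le_opnorm (bounded_by_real aM). Qed.

Lemma cvg_opnorm0 (T : Type) (F : set_system T) (FF : Filter F) (f : T -> l2 R -> l2 R)
    (u : T -> R) :
  (\forall x \near F, (opnorm (f x) <= (u x)%:E)%E) -> u @ F --> (0 : R) ->
  opnorm (f x) @[x --> F] --> 0%E.
Proof.
move=> fu u0; apply: (@squeeze_cvge _ _ _ _ (cst 0%E) _ (EFin \o u)).
- by apply: filterS fu => x fu; rewrite opnorm_ge0.
- exact: cvg_cst.
- by apply: cvg_EFin; [exact: nearW|exact: u0].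
Qed.

Lemma cvg_opnorm0_le (T : Type) (F : set_system T) (FF : Filter F) (f : T -> l2 R -> l2 R) :
  opnorm (f x) @[x --> F] --> 0%E ->
  forall e : R, 0 < e -> \forall x \near F, (opnorm (f x) <= e%:E)%E.
Proof.
move=> f0 e e0; have ffin := cvg_is_fine f0.
have /(_ FF)/cvgrPdist_le/(_ e e0) := fine_cvg f0; apply: filterS2 ffin => x fx.
by rewrite sub0r normrN => /(le_trans (ler_norm _)); rewrite -lee_fin fineK.
Qed.

Lemma uniform_cvgP (A : set R) (f : nat -> R -> R[i]^o) (g : R -> R[i]^o) :
  {uniform A, f @ \oo --> g} <->
  forall e : R, 0 < e -> \forall n \near \oo, forall x, A x -> cabs (g x - f n x) <= e.
Proof.
split=> [fg e e0|fg P /uniform_nbhs[E [entE EP]]].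
  apply: (fg [set h | forall x, A x -> cabs (g x - h x) <= e]); apply/uniform_nbhs.
  exists [set xy : R[i]^o * R[i]^o | cabs (xy.1 - xy.2) <= e]; split => //.
  rewrite -entourage_ballE; exists e%:C; first by rewrite /= ltcR.
  by move=> [x y] /=; rewrite -ball_normE/= -[`|_|]Re_normcE ltcR => /ltW.
move: entE; rewrite -entourage_ballE => -[[e e']]; rewrite /= ltcE/= => /andP[/eqP -> e0] eE.
have := fg _ (divr_gt0 e0 (ltr0Sn R 1)); apply: filterS => n fgn.
apply: EP => x Ax; apply: eE => /=; rewrite -ball_normE/= -[`|_|]Re_normcE.
by rewrite ltcR (le_lt_trans (fgn x Ax))// ltr_pdivrMr// ltr_pMr// ltr1n.
Qed.

Lemma funcalc_rdiag g a M : csmooth g -> (forall k, `|a k| <= M) ->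
  is_funcalc (rdiag a) g (diag (fun k => g (a k))).
Proof.
move=> sg aM; have cM := bounded_by_real aM; have [K K0 gK] := csmooth_bounded M sg.
have gaK : bounded_by (fun k => g (a k)) K by move=> k; exact: gK.
split; first exact: diag_bounded gaK.
(* The interval of radius [opnorm (rdiag a)] contains all the [a k], so one uniform approximation
   serves both the convergence of the polynomials and, entry by entry, that of the operators. *)
have /choice[p pP] n : exists p : {poly R[i]}, forall x,
    `|x| <= fine (opnorm (rdiag a)) -> cabs (p.[x%:C] - g x) <= harmonic n.
  by apply: weierstrass_complex sg _; rewrite invr_gt0.
exists p.
  apply/uniform_cvgP => e e0.
  have /cvgrPdist_le/(_ e e0) := @cvg_harmonic R.
  apply: filterS => n; rewrite sub0r normrN => ne x; rewrite /= in_itv/= -ler_norml => xa.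
  by rewrite -opprB cabsN (le_trans (pP _ _ xa))// (le_trans (ler_norm _)).
apply: (@cvg_opnorm0 _ _ _ _ harmonic); last exact: cvg_harmonic.
apply: nearW => n; rewrite (op_poly_diag _ cM).
have [N pN] := bounded_by_horner (p n) cM.
rewrite (diagB pN gaK); apply: opnorm_diag => k; apply: pP.
exact: abs_le_opnorm_rdiag aM.
Qed.

Lemma funcalc_entry g a M T n : (forall k, `|a k| <= M) -> is_funcalc (rdiag a) g T ->
  inner (T (std n)) (std n) = g (a n).
Proof.
move=> aM [_ [p /uniform_cvgP pg pT]]; have cM := bounded_by_real aM.
apply: cabs_eq0_le => e e0.
have [m [mT mg]] : exists m, (opnorm (op_poly (p m) (rdiag a) - T)%R <= e%:E)%E /\
    cabs (g (a n) - (p m).[(a n)%:C]) <= e.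
  near \oo => m; exists m; split; near: m; first exact: cvg_opnorm0_le.
  apply: filterS (pg e e0) => m; apply.
  by rewrite /= in_itv/= -ler_norml; exact: abs_le_opnorm_rdiag aM.
have := cabs_inner_std_le n mT.
rewrite [(_ - T) _]/(op_poly (p m) (rdiag a) (std n) - T (std n)) innerBl.
rewrite (op_poly_diag _ cM); have [N pN] := bounded_by_horner (p m) cM.
rewrite (inner_diag_std _ pN) => h.
rewrite -opprB cabsN -(subrKA (p m).[(a n)%:C]) (le_trans (cabsD _ _))// lerD.
Unshelve. all: by end_near. Qed.

End functional_calculus.

(** * Derivative along the path and Koplienko remainder *)

Section koplienko_remainder.
Context {R : realType}.
Implicit Types (g : R -> R[i]) (a b d : R^nat).

Definition cderive g (x : R) : R[i] :=
  derive1 (fun y => Re (g y)) x +i* derive1 (fun y => Im (g y)) x.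

Definition taylor_remainder g (a b : R) : R[i] := g a - g b - cderive g b * (a - b)%:C.

(** Reduces differentiability in operator norm to a Taylor estimate on each entry: the remainder is
    quadratic in [h], and one factor [h] cancels. *)
Lemma difference_quotientE g (x h d : R) : h != 0 ->
  (h^-1)%:C * (g (x + h * d) - g x) - cderive g x * d%:C =
  (h^-1)%:C * taylor_remainder g (x + h * d) x.
Proof.
move=> h0; rewrite /taylor_remainder [x + _ - x]addrC addKr [RHS]mulrBr; congr (_ - _).
by rewrite rmorphM/= mulrCA [_ * (h%:C * _)]mulrA -rmorphM/= mulVf// rmorph1 mul1r.
Qed.

Lemma csmooth_taylor g M : csmooth g -> exists2 K, 0 <= K & forall a b : R,
  `|a| <= M -> `|b| <= M -> cabs (taylor_remainder g a b) <= K * (a - b) ^+ 2.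
Proof.
move=> [gR gI]; have [K K0 RK] := smooth_taylor M gR; have [L L0 IL] := smooth_taylor M gI.
exists (K + L) => [|a b aM bM]; first exact: addr_ge0.
rewrite (le_trans (cabs_le_ReIm _))// mulrDl lerD//.
  by rewrite !Re_add !Re_opp Re_mul/= mulr0 subr0 RK.
by rewrite !Im_add !Im_opp Im_mul/= mulr0 add0r IL.
Qed.

Lemma cderive_bounded g M : csmooth g ->
  exists2 K, 0 <= K & forall x, `|x| <= M -> cabs (cderive g x) <= K.
Proof.
move=> [gR gI]; apply: (@csmooth_bounded _ (cderive g)).
by split; [exact: smooth_derive gR|exact: smooth_derive gI].
Qed.

Lemma rdiagD_scale a b M (t : R) : (forall k, `|a k| <= M) -> (forall k, `|b k| <= M) ->
  rdiag b + t%:C *: (rdiag a - rdiag b) = rdiag (fun k => b k + t * (a k - b k)).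
Proof.
move=> aM bM; have cM := bounded_by_real aM; have dM := bounded_by_real bM.
rewrite (diagB cM dM) (diagZ _ (bounded_byB cM dM)).
rewrite (diagD dM (bounded_byM (bounded_by_cst _) (bounded_byB cM dM))).
by congr diag; apply/funext => k; rewrite rmorphD rmorphM rmorphB.
Qed.

Lemma diag_op_derive0 g b d M N : csmooth g -> (forall k, `|b k| <= M) ->
  (forall k, `|d k| <= N) ->
  is_op_derive0 (fun t => diag (fun k => g (b k + t * d k)))
    (diag (fun k => cderive g (b k) * (d k)%:C)).
Proof.
move=> sg bM dN; have N0 : 0 <= N := le_trans (normr_ge0 _) (dN 0).
have [K' K'0 gK'] := cderive_bounded M sg.
have bD : bounded_by (fun k => cderive g (b k) * (d k)%:C) (K' * N).
  by apply: bounded_byM; [move=> k; exact: gK'|exact: bounded_by_real].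
split; first exact: diag_bounded bD.
have [K K0 gK] := csmooth_taylor (M + N) sg.
have [L L0 gL] := csmooth_bounded (M + N) sg.
have bF (t : R) : `|t| <= 1 -> forall k, `|b k + t * d k| <= M + N.
  move=> t1 k; rewrite (le_trans (ler_normD _ _))// lerD// normrM.
  by rewrite -[N]mul1r ler_pM.
have gF (t : R) : `|t| <= 1 -> bounded_by (fun k => g (b k + t * d k)) L.
  by move=> t1 k; exact/gL/bF.
(* The Taylor remainder of an entry is at most [K * (h * d k)^2], hence [K * N^2 * h^2] uniformly in
   k; division by [|h|] leaves this bound. Restricting to [|h| <= 1] keeps all arguments of [g] in
   [[-(M + N), M + N]], where [K] is valid. *)
apply: (@cvg_opnorm0 _ _ _ _ _ (fun h => K * N ^+ 2 * `|h|)); last first.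
  rewrite -[X in _ --> X](mulr0 (K * N ^+ 2)); apply: cvgM; first exact: cvg_cst.
  rewrite -[X in _ --> X](@normr0 _ R); apply: cvg_norm; exact: nbhs_dnbhs.
near=> h.
have h0 : h != 0 by near: h; exact: nbhs_dnbhs_neq.
have h1 : `|h| <= 1 by near: h; exact: dnbhs0_le.
have h00 : `|0 : R| <= 1 by rewrite normr0.
rewrite (diagB (gF _ h1) (gF _ h00)) (diagZ _ (bounded_byB (gF _ h1) (gF _ h00))).
rewrite (diagB (bounded_byM (bounded_by_cst _) (bounded_byB (gF _ h1) (gF _ h00))) bD).
apply: opnorm_diag => k.
rewrite mul0r addr0; set x := b k + h * d k.
rewrite difference_quotientE// -/x.
rewrite cabsM cabs_real normfV mulrC ler_pdivrMr ?normr_gt0//.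
apply: le_trans (gK _ _ (bF _ h1 k) _) _.
  by rewrite (le_trans (bM k))// lerDl.
rewrite (_ : x - b k = h * d k); last by rewrite /x addrC addKr.
rewrite (_ : K * N ^+ 2 * `|h| * `|h| = K * (`|h| ^+ 2 * N ^+ 2)); last by ring.
rewrite exprMn real_normK ?num_real// -[d k ^+ 2]real_normK ?num_real//.
by rewrite ler_wpM2l// ler_wpM2l ?sqr_ge0// ler_sqr.
Unshelve. all: by end_near. Qed.

Lemma op_derive0_entry (F : R -> l2 R -> l2 R) (D : l2 R -> l2 R) g n (b d : R) :
  csmooth g -> (forall t, inner (F t (std n)) (std n) = g (b + t * d)) ->
  is_op_derive0 F D -> inner (D (std n)) (std n) = cderive g b * d%:C.
Proof.
move=> sg FE [_ FD]; apply/esym; apply: cabs_eq0_le => e e0.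
have [K K0 gK] := csmooth_taylor (`|b| + `|d|) sg.
have K1 : 0 < K * d ^+ 2 + 1 by rewrite ltr_wpDl// mulr_ge0 ?sqr_ge0.
(* The third bound gives [|h| * (K * d^2) <= e]; the added 1 covers the case [K * d^2 = 0]. *)
have [h [h0 h1 hK hD]] : exists h : R, [/\ h != 0, `|h| <= 1, `|h| <= e / (K * d ^+ 2 + 1) &
    (opnorm ((h^-1)%:C *: (F h - F 0) - D)%R <= e%:E)%E].
  near (0 : R)^' => h; exists h; split; near: h.
  - exact: nbhs_dnbhs_neq.
  - exact: dnbhs0_le.
  - by apply: dnbhs0_le; rewrite divr_gt0.
  - exact: cvg_opnorm0_le.
have := cabs_inner_std_le n hD.
rewrite [(_ - D) _]/((h^-1)%:C *: (F h (std n) - F 0 (std n)) - D (std n)).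
rewrite innerBl innerZl innerBl !FE mul0r addr0 => hle.
set q := (h^-1)%:C * _ in hle.
rewrite -(subrKA q) (le_trans (cabsD _ _))// lerD//.
set x := b + h * d; have xb : x - b = h * d by rewrite /x addrC addKr.
rewrite -opprB /q difference_quotientE// -/x.
rewrite cabsN cabsM cabs_real normfV mulrC ler_pdivrMr ?normr_gt0//.
have xbd : `|x| <= `|b| + `|d|.
  by rewrite (le_trans (ler_normD _ _))// lerD2l normrM ler_piMl.
apply: le_trans (gK _ _ xbd _) _; first by rewrite lerDl.
rewrite xb exprMn -[h ^+ 2]real_normK ?num_real// [e * _]mulrC.
rewrite (_ : K * (`|h| ^+ 2 * d ^+ 2) = `|h| * (`|h| * (K * d ^+ 2))); last by ring.
rewrite ler_wpM2l//; move: hK; rewrite ler_pdivlMr//; apply: le_trans.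
by rewrite ler_wpM2l// lerDl.
Unshelve. all: by end_near. Qed.

Section diagonal_pair.
Variables (a b : R^nat) (M : R).
Hypotheses (aM : forall k, `|a k| <= M) (bM : forall k, `|b k| <= M).

Lemma koplienko_remainder_rdiag g : csmooth g ->
  is_koplienko_remainder (rdiag a) (rdiag b) g
    (diag (fun k => taylor_remainder g (a k) (b k))).
Proof.
move=> sg; have [K K0 gK] := csmooth_bounded M sg.
have [L L0 gL] := cderive_bounded M sg.
have abM k : `|a k - b k| <= M + M by rewrite (le_trans (ler_normB _ _))// lerD.
have gaK : bounded_by (fun k => g (a k)) K by move=> k; exact: gK.
have gbK : bounded_by (fun k => g (b k)) K by move=> k; exact: gK.
have gbL : bounded_by (fun k => cderive g (b k) * (a k - b k)%:C) (L * (M + M)).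
  by apply: bounded_byM; [move=> k; exact: gL|exact: bounded_by_real].
exists (diag (fun k => g (a k))), (diag (fun k => g (b k))),
  (diag (fun k => cderive g (b k) * (a k - b k)%:C)),
  (fun t => diag (fun k => g (b k + t * (a k - b k)))).
split.
- exact: funcalc_rdiag sg aM.
- exact: funcalc_rdiag sg bM.
- move=> t; rewrite (rdiagD_scale t aM bM).
  apply: (@funcalc_rdiag _ _ _ (M + `|t| * (M + M)) sg) => k.
  by rewrite (le_trans (ler_normD _ _))// lerD// normrM ler_wpM2l.
- exact: diag_op_derive0 sg bM abM.
- by rewrite (diagB gaK gbK) (diagB (bounded_byB gaK gbK) gbL).
Qed.

(** Used for uniqueness: it applies to every remainder, whichever functional calculus, path and
    derivative produced it. *)
Lemma koplienko_remainder_entry g T n : csmooth g ->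
  is_koplienko_remainder (rdiag a) (rdiag b) g T ->
  inner (T (std n)) (std n) = taylor_remainder g (a n) (b n).
Proof.
move=> sg [GA [GB [D [F [hA hB hF hD ->]]]]].
rewrite [(_ - _) _]/(GA (std n) - GB (std n) - D (std n)) !innerBl.
rewrite (funcalc_entry n aM hA) (funcalc_entry n bM hB).
rewrite (@op_derive0_entry F D g n (b n) (a n - b n) sg _ hD)// => t.
have := hF t; rewrite (rdiagD_scale t aM bM).
apply: (@funcalc_entry _ _ _ (M + `|t| * (M + M))) => k.
rewrite (le_trans (ler_normD _ _))// lerD// normrM ler_wpM2l//.
by rewrite (le_trans (ler_normB _ _))// lerD.
Qed.

End diagonal_pair.
End koplienko_remainder.

(** * Spectral shift functions of diagonal pairs *)

Section triangles.
Context {R : realType}.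
Local Notation mu := (@lebesgue_measure R).
Implicit Types (a b x : R) (f : R -> R).

(* The spectral shift function of the one-dimensional pair a, b: it vanishes
   at a and jumps to the height |a - b| at b. *)
Definition tri a b x : R := `|a - x| * \1_(`[Num.min a b, Num.max a b[%classic) x.

Lemma tri_ge0 a b x : 0 <= tri a b x.
Proof. by rewrite mulr_ge0// indicE. Qed.

Lemma measurable_tri a b : measurable_fun setT (tri a b).
Proof.
apply: measurable_funM; last exact: measurable_indic.
by apply: measurableT_comp => //; exact: measurable_funB.
Qed.

Lemma tri_eq0 a b x M : `|a| <= M -> `|b| <= M -> M < `|x| -> tri a b x = 0.
Proof.
rewrite !ler_norml => /andP[a1 a2] /andP[b1 b2] Mx.
rewrite /tri indicE memNset ?mulr0//= in_itv/= => /andP[].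
rewrite minElt maxElt; move: Mx; case: (ltP 0 x) => x0; first rewrite gtr0_norm//.
  by case: ifP => _; lra.
by rewrite ler0_norm//; case: ifP => _; lra.
Qed.

(** An antiderivative of [f'' x * (a - x)] is [f' x * (a - x) + f x]. The factor [s] stands for the
    constant sign of [a - x] on the interval. *)
Lemma smooth_ftc f s a u v : smooth f -> u < v ->
  \int[mu]_(x in `[u, v[) (s * (derive1n 2 f x * (a - x))) =
  s * (derive1 f v * (a - v) + f v - (derive1 f u * (a - u) + f u)).
Proof.
move=> sf uv; pose F x := s * (derive1 f x * (a - x) + f x).
pose q x := s * (derive1n 2 f x * (a - x)).
have dF (x : R) : is_derive x (1 : R) F (q x).
  have h1 := smooth_is_derive x (smooth_derive sf); have h2 := smooth_is_derive x sf.
  by rewrite /F /q; apply: is_derive_eq; rewrite /GRing.scale/=; ring.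
have cq : continuous q.
  move=> x; apply: cvgM; first exact: cvg_cst.
  apply: cvgM; first exact: (smooth_continuous (smooth_derive (smooth_derive sf))).
  by apply: cvgB; [exact: cvg_cst|exact: cvg_id].
have cF : continuous F.
  by move=> x; apply/differentiable_continuous/derivable1_diffP; exact: ex_derive.
have cqw : {within `[u, v], continuous q} by exact: continuous_subspaceT.
rewrite Rintegral_itv_bndo_bndc; last first.
  have : mu.-integrable `[u, v] (EFin \o q).
    by apply: continuous_compact_integrable => //; exact: segment_compact.
  by apply: integrableS => //; exact: subset_itv_co_cc.
rewrite /Rintegral (@continuous_FTC2 _ q F)//.
- rewrite /F/=; ring.
- split.
  + by move=> x _; exact: ex_derive.
  + exact/cvg_at_right_filter/cF.
  + exact/cvg_at_left_filter/cF.
- by move=> x _; rewrite derive1E; exact: derive_val.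
Qed.

Lemma integral_tri f a b : smooth f ->
  \int[mu]_x (derive1n 2 f x * tri a b x) = f a - f b - derive1 f b * (a - b).
Proof.
(* Both orders of [a] and [b] follow from one computation, with [s = -1] for [a < b] and [s = 1] for
   [b < a]; for [a = b] the half-open interval is empty. *)
move=> sf; have key s u v : u < v -> Num.min a b = u -> Num.max a b = v ->
    (forall x, u <= x < v -> `|a - x| = s * (a - x)) ->
    \int[mu]_x (derive1n 2 f x * tri a b x) =
    s * (derive1 f v * (a - v) + f v - (derive1 f u * (a - u) + f u)).
  move=> uv minE maxE sE; rewrite -smooth_ftc// [RHS]Rintegral_mkcond.
  apply: eq_Rintegral => x _; rewrite /tri minE maxE patchE indicE.
  case: (boolP (x \in _)) => xuv; last by rewrite !mulr0.
  rewrite mulr1 sE; last by move: xuv; rewrite inE/= in_itv.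
  by rewrite mulrCA.
have [ab|ba|->] := ltgtP a b.
- have minE : Num.min a b = a by rewrite min_l// ltW.
  have maxE : Num.max a b = b by rewrite max_r// ltW.
  rewrite (key (-1) a b)//; first by ring.
  by move=> x /andP[ax _]; rewrite ler0_norm ?subr_le0//; ring.
- have minE : Num.min a b = b by rewrite min_r// ltW.
  have maxE : Num.max a b = a by rewrite max_l// ltW.
  rewrite (key 1 b a)//; first by ring.
  by move=> x /andP[_ xa]; rewrite ger0_norm ?subr_ge0 1?ltW//; ring.
- rewrite !subrr mulr0 subr0; under eq_Rintegral.
    move=> x _; rewrite /tri minxx maxxx set_itv_ge ?bnd_simp ?ltxx// indic0 !mulr0; over.
  by rewrite /Rintegral integral0.
Qed.

End triangles.

Section smooth_polynomials.
Context {R : realType}.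

Lemma derive1n_horner (p : {poly R}) n : derive1n n (horner p) = horner (p^`(n))%R.
Proof.
elim: n => [|n IH]; first by [].
rewrite derive1nS IH; apply/funext => x; rewrite derive1E.
by have := is_derive_poly (p^`(n))%R x => /@derive_val ->.
Qed.

Lemma smooth_horner (p : {poly R}) : smooth (horner p).
Proof. by move=> n x; rewrite derive1n_horner; exact: derivable_horner. Qed.

End smooth_polynomials.

Lemma Re_mulr_real (R : realType) (z : R[i]) (t : R) : Re (z * t%:C) = Re z * t.
Proof. by rewrite Re_mul/= mulr0 subr0. Qed.

Lemma Im_mulr_real (R : realType) (z : R[i]) (t : R) : Im (z * t%:C) = Im z * t.
Proof. by rewrite Im_mul/= mulr0 add0r. Qed.

(** * Sums of triangles and the trace formula *)

Section triangle_sums.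
Context {R : realType}.
Local Notation mu := (@lebesgue_measure R).
Variables (a b : R^nat) (M C : R).
Hypotheses (aM : forall k, `|a k| <= M) (bM : forall k, `|b k| <= M).
Hypothesis sumC : forall N x, \sum_(n < N) tri (a n) (b n) x <= C.

Definition tri_sum (a b : R^nat) (x : R) : R := limn (series (fun n => tri (a n) (b n) x)).

Let S N x := series (fun n => tri (a n) (b n) x) N.

Let S_ge0 N x : 0 <= S N x.
Proof. by rewrite /S/series/= sumr_ge0// => k _; exact: tri_ge0. Qed.

Let S_leC N x : S N x <= C.
Proof. by rewrite /S/series/= big_mkord. Qed.

Lemma cvg_tri_sum x : series (fun n => tri (a n) (b n) x) @ \oo --> tri_sum a b x.
Proof.
apply: nondecreasing_is_cvgn.
  by apply/nondecreasing_seqP => m; rewrite /series/= big_nat_recr//= lerDl tri_ge0.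
by exists C => _ [N _ <-]; exact: S_leC.
Qed.

Let S_eq0 N x : M < `|x| -> S N x = 0.
Proof. by move=> Mx; rewrite /S/series/= big1// => k _; rewrite (@tri_eq0 _ _ _ _ M). Qed.

Lemma tri_sum_eq0 x : M < `|x| -> tri_sum a b x = 0.
Proof.
move=> Mx; apply: cvg_lim => //.
rewrite (_ : series _ = cst 0); first exact: cvg_cst.
by apply/funext => N; exact: S_eq0.
Qed.

Let measurable_S N : measurable_fun setT (S N).
Proof.
rewrite /S/series/=; under eq_fun do rewrite big_mkord.
by apply: measurable_sum => k; exact: measurable_tri.
Qed.

Lemma measurable_tri_sum : measurable_fun setT (tri_sum a b).
Proof. by apply: (measurable_fun_cvg measurable_S) => x _; exact: cvg_tri_sum. Qed.

Let D x : R := C * \1_(`[- M, M]%classic) x.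

Let integrable_D (K : R) : mu.-integrable setT (EFin \o (fun x => K * D x)).
Proof.
have := integrable_indic_itv (- M) M true false => /(integrableZl measurableT (K * C)).
by apply: eq_integrable => // x _; rewrite /= -EFinM mulrA.
Qed.

Let S_leD N x : `|S N x| <= D x.
Proof.
rewrite ger0_norm// /D; have [xM|Mx] := leP `|x| M.
  by rewrite indicE mem_set ?mulr1//= in_itv/= -ler_norml.
by rewrite S_eq0// mulr_ge0// ?indicE// (le_trans (S_ge0 0 x)).
Qed.

Let D_ge0 x : 0 <= D x.
Proof. by apply: le_trans (S_leD 0 x). Qed.

Let absM_leD (q h : R -> R) (K : R) x : 0 <= K -> (forall x, `|x| <= M -> `|q x| <= K) ->
  (forall x, `|h x| <= D x) -> `|q x * h x| <= K * D x.
Proof.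
move=> K0 qK hD; rewrite normrM; have [xM|Mx] := leP `|x| M; first by rewrite ler_pM// qK.
have -> : h x = 0.
  apply/eqP; rewrite -normr_le0 (le_trans (hD x))// /D indicE memNset ?mulr0//=.
  by rewrite in_itv/= -ler_norml leNgt Mx.
by rewrite normr0 mulr0 mulr_ge0.
Qed.

Let integrable_qM (q h : R -> R) (K : R) : continuous q -> 0 <= K ->
  (forall x, `|x| <= M -> `|q x| <= K) -> measurable_fun setT h ->
  (forall x, `|h x| <= D x) -> mu.-integrable setT (EFin \o (fun x => q x * h x)).
Proof.
move=> cq K0 qK mh hD; apply: (le_integrable _ _ _ (integrable_D K)) => //.
  apply/measurable_EFinP; apply: measurable_funM => //; exact: continuous_measurable_fun.
move=> x _; rewrite /= lee_fin; apply: le_trans (ler_norm _); exact: absM_leD.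
Qed.

(** The partial sums are at most [D], that is [C] on [[-M, M]] and 0 elsewhere, so [K * D] is an
    integrable majorant. *)
Lemma dominated_tri_sum (q : R -> R) (K : R) : continuous q -> 0 <= K ->
  (forall x, `|x| <= M -> `|q x| <= K) ->
  mu.-integrable setT (EFin \o (fun x => q x * tri_sum a b x)) /\
  (fun N => \int[mu]_x (q x * S N x)) @ \oo --> \int[mu]_x (q x * tri_sum a b x).
Proof.
move=> cq K0 qK.
have mq : measurable_fun setT q by exact: continuous_measurable_fun.
have [|||||i1 _ i2] := @dominated_convergence _ _ _ mu setT measurableT
  (fun N x => (q x * S N x)%:E) (fun x => (q x * tri_sum a b x)%:E)
  (fun x => (K * D x)%:E).
- by move=> N; apply/measurable_EFinP; exact: measurable_funM mq (measurable_S N).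
- by apply/measurable_EFinP; exact: measurable_funM mq measurable_tri_sum.
- apply: aeW => x _; apply: cvg_EFin; first exact: nearW.
  by apply: cvgM; [exact: cvg_cst|exact: cvg_tri_sum].
- exact: integrable_D.
- by apply: aeW => x N _; rewrite lee_fin absM_leD.
split=> //; apply: fine_cvg.
rewrite /Rintegral fineK//; exact: integrable_fin_num.
Qed.

Lemma integrable_tri_sum : mu.-integrable setT (EFin \o tri_sum a b).
Proof.
have [|//|x _|+ _] := @dominated_tri_sum (cst 1) 1; [exact: cst_continuous|by rewrite normr1|].
by apply: eq_integrable => // x _; rewrite /= mul1r.
Qed.

(** By linearity and [integral_tri], a partial sum of Taylor remainders is the integral of [f'']
    against a partial sum of triangles; dominated convergence does the rest. *)
Lemma trace_series f : smooth f ->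
  series (fun n => f (a n) - f (b n) - derive1 f (b n) * (a n - b n)) @ \oo -->
  \int[mu]_x (derive1n 2 f x * tri_sum a b x).
Proof.
move=> sf; have sf2 := smooth_derive (smooth_derive sf).
have cf2 := smooth_continuous sf2.
have [K K0 fK] := smooth_bounded M sf2.
have [_] := dominated_tri_sum cf2 K0 fK.
suff -> : (fun N => \int[mu]_x (derive1n 2 f x * S N x)) =
  series (fun n => f (a n) - f (b n) - derive1 f (b n) * (a n - b n)) by [].
have itri N : mu.-integrable setT (EFin \o (fun x => derive1n 2 f x * tri (a N) (b N) x)).
  apply: integrable_qM cf2 K0 fK (measurable_tri _ _) _ => x.
  rewrite ger0_norm ?tri_ge0// (le_trans _ (S_leD N.+1 x))// (le_trans _ (ler_norm _))//.
  by rewrite /S seriesSr lerDr S_ge0.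
apply/funext; elim=> [|N IH].
  by rewrite /series/= big_geq// /S; under eq_Rintegral do
    rewrite /series/= big_geq// mulr0; rewrite /Rintegral integral0.
rewrite seriesSr -IH -integral_tri// -RintegralD//; last first.
  exact: integrable_qM cf2 K0 fK (measurable_S N) (S_leD N).
by apply: eq_Rintegral => x _; rewrite /S seriesSr mulrDr.
Qed.

(** The Taylor remainder of [x^2] is exactly [(a - b)^2], so this is an instance of [trace_series].
    Every later absolute convergence is derived from it. *)
Lemma cvg_sum_sqr : cvgn (series (fun n => (a n - b n) ^+ 2)).
Proof.
pose p : {poly R} := 'X^2.
have <- : (fun n => p.[a n] - p.[b n] - derive1 (horner p) (b n) * (a n - b n)) =
    (fun n => (a n - b n) ^+ 2).
  apply/funext => n; rewrite -derive1n1 derive1n_horner /p derivn1 derivXn !hornerE/=.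
  by ring.
by apply: cvgP; exact: (trace_series (@smooth_horner R p)).
Qed.

Lemma cvg_taylor_remainder g : csmooth g ->
  cvgn [series cabs (taylor_remainder g (a k) (b k))]_k.
Proof.
move=> sg; have [K K0 gK] := csmooth_taylor M sg.
apply: (series_le_cvg (v_ := fun k => K * (a k - b k) ^+ 2)).
- by move=> n; exact: cabs_ge0.
- by move=> n; rewrite mulr_ge0 ?sqr_ge0.
- by move=> n; exact: gK.
- by apply: cvg_seriesZ; exact: cvg_sum_sqr.
Qed.

Lemma csum_taylor_remainder g : csmooth g ->
  csum (fun k => taylor_remainder g (a k) (b k)) =
  cintegral (fun x => cderive2 g x * (tri_sum a b x)%:C).
Proof.
move=> [gR gI]; rewrite /csum /cintegral; congr (_ +i* _).
  under eq_fun do rewrite /taylor_remainder !Re_add !Re_opp Re_mulr_real/=.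
  rewrite (cvg_lim _ (trace_series gR))//; apply: eq_Rintegral => x _.
  by rewrite Re_mulr_real.
under eq_fun do rewrite /taylor_remainder !Im_add !Im_opp Im_mulr_real/=.
rewrite (cvg_lim _ (trace_series gI))//; apply: eq_Rintegral => x _.
by rewrite Im_mulr_real.
Qed.

End triangle_sums.

#[global] Instance lebesgue_ae_filter (R : realType) :
  Filter (nbhs (almost_everywhere (@lebesgue_measure R))).
Proof. exact: ae_filter_ringOfSetsType. Qed.

(** * Uniqueness *)

Section moments.
Context {R : realType}.
Local Notation mu := (@lebesgue_measure R).
Implicit Types (h : R -> R) (p : {poly R}).

Lemma poly_cvg_indic (c M : R) : exists p : nat -> {poly R},
  (forall k x, `|x| <= M -> `|(p k).[x]| <= 2) /\
  (forall x, `|x| <= M -> (p k).[x] @[k --> \oo] --> (\1_(`]-oo, c]%classic) x : R)).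
Proof.
(* A continuous ramp: 1 up to [c], then falling with slope [-(k + 1)] to 0. It is Lipschitz, so
   Weierstrass gives a polynomial within [1 / (k + 1)] of it; the bound 2 is 1 for the ramp plus at
   most 1 for the error. *)
pose L (k : nat) (x : R) := Num.max 0 (1 - k.+1%:R * Num.max 0 (x - c)).
have L01 k x : 0 <= L k x <= 1.
  rewrite /L; set m := Num.max 0 (x - c).
  have m0 : 0 <= m by rewrite le_max lexx.
  rewrite le_max lexx/= ge_max ler01/= lerBlDr lerDl mulr_ge0//.
have max_lip (s t : R) : `|Num.max 0 s - Num.max 0 t| <= `|s - t|.
  by rewrite !maxElt; case: (ltP 0 s) => hs; case: (ltP 0 t) => ht;
    rewrite ?subrr ?normr0// ?subr0 ?sub0r ler_norml; apply/andP; split;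
    case: (ler0P (s - t)); lra.
have Llip k x y : `|L k x - L k y| <= k.+1%:R * `|x - y|.
  rewrite (le_trans (max_lip _ _))//.
  rewrite (_ : 1 - _ - _ = k.+1%:R * (Num.max 0 (y - c) - Num.max 0 (x - c))); last by ring.
  rewrite normrM ger0_norm// ler_wpM2l// (le_trans (max_lip _ _))//.
  by rewrite distrC (_ : x - c - (y - c) = x - y)//; ring.
have /choice[p pL] k : exists p, forall x, `|x| <= M -> `|p.[x] - L k x| <= harmonic k.
  by apply: (@weierstrass_lipschitz _ (L k) k.+1%:R) => //; rewrite invr_gt0.
exists p; split=> [k x xM|x xM].
  rewrite -[(p k).[x]](subrK (L k x)) (le_trans (ler_normD _ _))//.
  rewrite -[leRHS]/(1 + 1) lerD//.
    by rewrite (le_trans (pL k x xM))//= invf_le1// ler1n.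
  by have /andP[? ?] := L01 k x; rewrite ger0_norm.
have LP : L k x @[k --> \oo] --> (\1_(`]-oo, c]%classic) x : R).
  apply: cvg_near_cst; rewrite indicE; have [xc|cx] := leP x c.
    rewrite mem_set/=; last by rewrite in_itv.
    by apply: nearW => k; rewrite /L [Num.max 0 (x - c)]max_l ?subr_le0// mulr0 subr0 max_r.
  rewrite memNset/=; last by rewrite in_itv/= leNgt cx.
  near=> k; rewrite /L [Num.max 0 (x - c)]max_r ?subr_ge0 1?ltW// max_l//.
  rewrite subr_le0 -ler_pdivrMr ?subr_gt0//.
  near: k; apply: filterS (nbhs_infty_ger (1 / (x - c))) => k /le_trans; apply.
  by rewrite ler_nat.
rewrite (_ : (fun k => _) = (fun k => ((p k).[x] - L k x) + L k x)); last first.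
  by apply/funext => k; rewrite subrK.
rewrite -[X in _ --> X]add0r; apply: cvgD => //.
apply/cvgrPdist_le => e e0; have /cvgrPdist_le/(_ e e0) := @cvg_harmonic R.
apply: filterS => k; rewrite !sub0r !normrN => ke.
by rewrite (le_trans (pL k x xM))// (le_trans (ler_norm _)).
Unshelve. all: by end_near. Qed.

(** Indicators of half-lines are bounded pointwise limits of polynomials on [[-M, M]], so the
    integral of [h] over every half-line is 0; Lebesgue differentiation of this primitive gives back
    [h] almost everywhere. *)
Lemma moments_eq0 h M : mu.-integrable setT (EFin \o h) ->
  (forall x, M < `|x| -> h x = 0) ->
  (forall p, \int[mu]_x (p.[x] * h x) = 0) ->
  {ae mu, forall x, h x = 0}.
Proof.
move=> ih h0 mom.
have mh : measurable_fun setT h by have /integrableP[/measurable_EFinP] := ih.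
have F0 c : \int[mu]_(x in `]-oo, c]) h x = 0.
  have [p [p2 pc]] := poly_cvg_indic c M.
  have [|||||j _ cI] := @dominated_convergence _ _ _ mu setT measurableT
    (fun k x => ((p k).[x] * h x)%:E) (fun x => (\1_(`]-oo, c]%classic) x * h x)%:E)
    (fun x => (2 * `|h x|)%:E).
  - move=> k; apply/measurable_EFinP; apply: (measurable_funM _ mh).
    by apply: continuous_measurable_fun => x; exact: continuous_horner.
  - apply/measurable_EFinP; apply: measurable_funM => //; exact: measurable_indic.
  - apply: aeW => x _; apply: cvg_EFin; first exact: nearW.
    have [xM|Mx] := leP `|x| M; first by apply: cvgM; [exact: pc|exact: cvg_cst].
    by rewrite /comp/= h0// mulr0; under eq_fun do rewrite mulr0; exact: cvg_cst.
  - have := integrableZl measurableT 2 (integrable_norm ih).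
    by apply: eq_integrable => // x _; rewrite /= EFinM.
  - apply: aeW => x k _; rewrite lee_fin normrM.
    have [xM|Mx] := leP `|x| M; first by rewrite ler_wpM2r// p2.
    by rewrite h0// normr0 !mulr0.
  have cE : \int[mu]_x ((p k).[x] * h x) @[k --> \oo] -->
      \int[mu]_x (\1_(`]-oo, c]%classic) x * h x).
    by apply: fine_cvg; rewrite /Rintegral fineK//; exact: integrable_fin_num.
  have E : \int[mu]_x (\1_(`]-oo, c]%classic) x * h x) = 0.
    have c0 : \int[mu]_x ((p k).[x] * h x) @[k --> \oo] --> (0 : R).
      by apply: cvg_near_cst; apply: nearW => k; exact: mom.
    by rewrite -(cvg_lim (@Rhausdorff R) cE) (cvg_lim (@Rhausdorff R) c0).
  rewrite Rintegral_mkcond -[RHS]E; apply: eq_Rintegral => x _.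
  by rewrite patchE indicE; case: (x \in _); rewrite ?mul1r ?mul0r.
have iy y : mu.-integrable `]-oo, y] (EFin \o h) by exact: integrableS ih.
have lh : locally_integrable setT h by apply: open_integrable_locally => //; exact: openT.
have := FTC1Ny iy lh; apply: filterS => x [_ <-].
rewrite (_ : (fun c => _) = cst 0) ?derive1_cst//; apply/funext => c; exact: F0.
Qed.

(** A shift function vanishes only almost everywhere outside the interval, while [moments_eq0] asks
    for it everywhere; truncation bridges this without changing the moments, and makes the products
    with polynomials integrable. *)
Lemma moment_restrict e M p : mu.-integrable setT (EFin \o e) ->
  {ae mu, forall x, M <= `|x| -> e x = 0} ->
  let I := `]- M, M[%classic in
  mu.-integrable setT (EFin \o (fun x => p.[x] * (e x * \1_I x))) /\
  \int[mu]_x (p.[x] * (e x * \1_I x)) = \int[mu]_x (p.[x] * e x).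
Proof.
move=> ie e0 I; have me : measurable_fun setT e by have /integrableP[/measurable_EFinP] := ie.
have mp : measurable_fun setT (horner p).
  by apply: continuous_measurable_fun => x; exact: continuous_horner.
have mI : measurable_fun setT (fun x => e x * \1_I x).
  by apply: measurable_funM => //; apply: measurable_indic; exact: measurable_itv.
split.
  have [K K0 pK] := smooth_bounded M (@smooth_horner R p).
  apply: (@le_integrable _ _ _ mu setT measurableT _ (EFin \o (fun x => K * `|e x|))).
  - by apply/measurable_EFinP; exact: measurable_funM mp mI.
  - move=> x _; rewrite /= lee_fin normrM [leRHS]ger0_norm ?mulr_ge0// indicE.
    have [xI|xI] := boolP (x \in I); last by rewrite mulr0 normr0 mulr0 mulr_ge0.
    rewrite mulr1 ler_wpM2r// pK//; move: xI.
    by rewrite inE /I/= in_itv/= -ltr_norml => /ltW.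
  - have := integrableZl measurableT K (integrable_norm ie).
    by apply: eq_integrable => // x _; rewrite /= EFinM.
rewrite /Rintegral; congr fine; apply: ae_eq_integral => //.
- by apply/measurable_EFinP; exact: measurable_funM mp mI.
- by apply/measurable_EFinP; exact: measurable_funM mp me.
apply: filterS e0 => x ex _; rewrite /= indicE.
have [xI|xI] := boolP (x \in I); first by rewrite mulr1.
rewrite mulr0 ex//; move: xI; rewrite notin_setE /I/= in_itv/= -ltr_norml => /negP.
by rewrite -leNgt.
Qed.

Lemma moments_unique (e1 e2 : R -> R) M :
  mu.-integrable setT (EFin \o e1) -> mu.-integrable setT (EFin \o e2) ->
  {ae mu, forall x, M <= `|x| -> e1 x = 0} -> {ae mu, forall x, M <= `|x| -> e2 x = 0} ->
  (forall p, \int[mu]_x (p.[x] * e1 x) = \int[mu]_x (p.[x] * e2 x)) ->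
  {ae mu, forall x, e1 x = e2 x}.
Proof.
move=> i1 i2 z1 z2 mom; pose I := `]- M, M[%classic.
pose h (x : R) := e1 x * \1_I x - e2 x * \1_I x.
have h0 : {ae mu, forall x, h x = 0}.
  apply: (@moments_eq0 _ M).
  - have [j1 _] := moment_restrict 1%:P i1 z1; have [j2 _] := moment_restrict 1%:P i2 z2.
    have := integrableB measurableT j1 j2; apply: eq_integrable => // x _.
    by rewrite /= !hornerC !mul1r.
  - move=> x Mx; rewrite /h indicE memNset ?mulr0 ?subrr// /I/= in_itv/= -ltr_norml.
    by apply/negP; rewrite -leNgt ltW.
  - move=> p; have [j1 E1] := moment_restrict p i1 z1; have [j2 E2] := moment_restrict p i2 z2.
    rewrite /h; under eq_Rintegral do rewrite mulrBr.
    by rewrite RintegralB// E1 E2 mom subrr.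
apply: filterS3 h0 z1 z2 => x; rewrite /h indicE.
have [xI /eqP|xI _ ex1 ex2] := boolP (x \in I).
  by rewrite !mulr1 subr_eq0 => /eqP.
have Mx : M <= `|x|.
  by move: xI; rewrite notin_setE /I/= in_itv/= -ltr_norml => /negP; rewrite -leNgt.
by rewrite ex1// ex2.
Qed.

End moments.

(** * The spectral shift function of a diagonal pair *)

Section koplienko_diagonal.
Context {R : realType}.
Local Notation mu := (@lebesgue_measure R).

Lemma ae_countable (A : set R) : countable A -> {ae mu, forall x, ~ A x}.
Proof.
move=> cA; exists A; split.
- exact: countable_measurable.
- exact: countable_lebesgue_measure0.
- by move=> x /contrapT.
Qed.

Lemma poly_antideriv (q : {poly R}) : exists p : {poly R}, p^`() = q.
Proof.
exists (\poly_(i < (size q).+1) (q`_i.-1 / i%:R)); apply/polyP => i.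
rewrite coef_deriv coef_poly ltnS; case: ltnP => iq.
  by rewrite -[LHS]mulr_natr divfK// pnatr_eq0.
by rewrite mul0rn nth_default.
Qed.

Lemma csmooth_real (f : R -> R) : smooth f -> csmooth (fun x => (f x)%:C).
Proof.
move=> sf; split; first exact: sf.
have -> : (fun x => Im (f x)%:C) = horner (0 : {poly R}).
  by apply/funext => x; rewrite horner0.
exact: smooth_horner.
Qed.

Variables (a b : R^nat) (M C : R).
Hypotheses (aM : forall k, `|a k| <= M) (bM : forall k, `|b k| <= M).
Hypothesis sumC : forall N x, \sum_(n < N) tri (a n) (b n) x <= C.

Lemma koplienko_formula_rdiag : koplienko_formula (rdiag a) (rdiag b) (tri_sum a b).
Proof.
split; first exact: integrable_tri_sum aM bM sumC.
  set m := Num.max _ _; have am k : `|a k| <= m.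
    by rewrite le_max; apply/orP; left; exact: (abs_le_opnorm_rdiag k aM).
  have bm k : `|b k| <= m.
    by rewrite le_max; apply/orP; right; exact: (abs_le_opnorm_rdiag k bM).
  (* The sum is known to vanish for [|x| > m], whereas the formula starts at [|x| = m]. A triangle
     is closed on its left, so it may be nonzero at [-m]; the two points are discarded as a null
     set. *)
  have : {ae mu, forall x, ~ [set m; - m] x}.
    by apply: ae_countable; apply: finite_set_countable; exact: finite_set2.
  apply: filterS => x xm mx; apply: (tri_sum_eq0 am bm).
  rewrite lt_neqAle mx andbT; apply/eqP => mxE; apply: xm => /=.
  by case: (ger0P x) mxE => _ ->; [left|right; rewrite opprK].
move=> g sg; exists (diag (fun k => taylor_remainder g (a k) (b k))).
  exact: koplienko_remainder_rdiag.
have ct := cvg_taylor_remainder aM bM sumC sg.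
split; first exact: diag_trace_class.
by rewrite -(csum_taylor_remainder aM bM sumC sg); exact: diag_trace.
Qed.

(** A rival [eta] comes with a remainder [T] whose trace in the standard basis is the same series of
    Taylor remainders, so both functions have the same integral against [g'']; every polynomial is
    such a second derivative. *)
Lemma KoSSF_rdiag : is_KoSSF (rdiag a) (rdiag b) (tri_sum a b).
Proof.
have K := koplienko_formula_rdiag; split=> // eta [ieta eta0 etaK].
have [i1 z1 _] := K; apply: (moments_unique ieta i1 eta0 z1) => q.
have [p1 p1E] := poly_antideriv q; have [p p2E] := poly_antideriv p1.
pose g x := (p.[x])%:C; have sg : csmooth g by exact/csmooth_real/smooth_horner.
have [T hT [_ trT]] := etaK g sg.
have E : cintegral (fun x => cderive2 g x * (eta x)%:C) =
    cintegral (fun x => cderive2 g x * (tri_sum a b x)%:C).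
  rewrite -(csum_taylor_remainder aM bM sumC sg).
  have entry n := koplienko_remainder_entry aM bM n sg hT.
  have trE : series (fun n => inner (T (std n)) (std n) : R[i]^o) =
      series (fun n => taylor_remainder g (a n) (b n) : R[i]^o).
    by congr series; apply/funext => n; exact: entry.
  have ct := cvg_csum (csummable_cabs (cvg_taylor_remainder aM bM sumC sg)).
  have := trT std std_basis; rewrite trE => ct'.
  exact: (cvg_unique (@norm_hausdorff _ (R[i]^o)) ct' ct).
have dE x : Re (cderive2 g x) = q.[x].
  rewrite -[LHS]/(derive1n 2 (horner p) x).
  by rewrite derive1n_horner derivnS derivn1 p2E p1E.
have Re_E (e : R -> R) : Re (cintegral (fun x => cderive2 g x * (e x)%:C)) =
    \int[mu]_x (q.[x] * e x).
  by apply: eq_Rintegral => x _; rewrite Re_mulr_real dE.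
by rewrite -!Re_E E.
Qed.

End koplienko_diagonal.

(** * Riemann integrable functions *)

Section step_functions.
Context {R : realType}.
Local Notation mu := (@lebesgue_measure R).
Implicit Types (phi : R -> R -> R) (a b x : R) (s : seq R) (f : R -> R).

(** Cells are half-open, so that they tile the interval, and the value on a cell is computed from
    its endpoints; taking for [phi] the infimum or supremum of [f] over the closed cell gives the
    Darboux step functions. *)
Fixpoint stepf phi a s x : R :=
  if s is y :: s' then phi a y * \1_(`[a, y[%classic) x + stepf phi y s' x else 0.

Fixpoint stepsum phi a s : R :=
  if s is y :: s' then phi a y * (y - a) + stepsum phi y s' else 0.

Lemma stepsum_big phi a s : stepsum phi a s =
  \sum_(i < size s) phi (nth a (a :: s) i) (nth a s i) * cell_length a s i.
Proof.
elim: s a => [|y s IH] a; first by rewrite big_ord0.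
rewrite [LHS]/= IH big_ord_recl; congr (_ + _); apply: eq_bigr => i _.
rewrite /cell_length lift0 [nth a (_ :: s) _.+1]/= [nth a (a :: _) _.+1]/=.
by rewrite !(set_nth_default y a (ltn_ord i)) !(set_nth_default y a (leqW (ltn_ord i) : i < size (y :: s))%N).
Qed.

Lemma lower_sumE f a s : lower_sum f a s = stepsum (fun p q => inf (f @` `[p, q])) a s.
Proof. by rewrite stepsum_big. Qed.

Lemma upper_sumE f a s : upper_sum f a s = stepsum (fun p q => sup (f @` `[p, q])) a s.
Proof. by rewrite stepsum_big. Qed.

Lemma path_le_last a s : path <%R a s -> a <= last a s.
Proof.
by elim: s a => [|y s IH] a //= /andP[ay /IH]; apply: le_trans; exact: ltW.
Qed.

Lemma stepf_lt phi a s x : path <%R a s -> x < a -> stepf phi a s x = 0.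
Proof.
elim: s a => [|y s IH] a //= /andP[ay ys] xa.
rewrite indicE memNset ?mulr0 ?add0r ?(IH y)//; first exact: lt_trans ay.
by rewrite /= in_itv/= leNgt xa.
Qed.

Lemma stepf_ge phi a s x : path <%R a s -> last a s <= x -> stepf phi a s x = 0.
Proof.
elim: s a => [|y s IH] a //= /andP[ay ys] xl; rewrite IH// addr0 indicE memNset ?mulr0//.
by rewrite /= in_itv/= ltNge (le_trans (path_le_last ys) xl) andbF.
Qed.

Lemma stepf_cell phi a s x : path <%R a s -> a <= x < last a s ->
  exists p q, [/\ p \in a :: s, p <= x < q, a <= p, q <= last a s & stepf phi a s x = phi p q].
Proof.
elim: s a => [|y s IH] a /=; first by move=> _ /andP[ax xa]; have := le_lt_trans ax xa; rewrite ltxx.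
move=> /andP[ay ys] /andP[ax xl]; have [xy|yx] := ltP x y.
  exists a, y; split; rewrite ?mem_head// ?ax//; first exact: path_le_last.
  by rewrite stepf_lt// addr0 indicE mem_set ?mulr1//= in_itv/= ax.
have [|p [q [ps pxq yp ql E]]] := IH y ys; first by rewrite yx.
exists p, q; split => //; first by rewrite inE ps orbT.
  exact: le_trans (ltW ay) yp.
by rewrite E indicE memNset ?mulr0 ?add0r//= in_itv/= ltNge yx andbF.
Qed.

Lemma integrable_stepf phi a s : mu.-integrable setT (EFin \o stepf phi a s).
Proof.
elim: s a => [|y s IH] a; first exact: integrable0.
have := integrableZl measurableT (phi a y) (integrable_indic_itv a y true true).
move=> /(integrableD measurableT) /(_ (IH y)).
by apply: eq_integrable => // x _; rewrite /= EFinD EFinM.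
Qed.

Lemma Rintegral_stepf phi a s : path <%R a s ->
  \int[mu]_x stepf phi a s x = stepsum phi a s.
Proof.
elim: s a => [|y s IH] a /=; first by rewrite /Rintegral integral0.
move=> /andP[ay ys].
have i1 : mu.-integrable setT (EFin \o \1_(`[a, y[%classic : set R)).
  exact: integrable_indic_itv.
rewrite RintegralD//; last first.
- exact: integrable_stepf.
- have := integrableZl measurableT (phi a y) i1.
  by apply: eq_integrable => // x _; rewrite /= EFinM.
rewrite IH// RintegralZl//; congr (_ * _ + _).
rewrite /Rintegral integral_indic//= setIT lebesgue_measure_itv/= lte_fin ay.
by [].
Qed.

Lemma le_stepsum phi psi a s : path <%R a s -> (forall p q, p < q -> phi p q <= psi p q) ->
  stepsum phi a s <= stepsum psi a s.
Proof.
elim: s a => [|y s IH] a //= /andP[ay ys] pp.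
by rewrite lerD ?IH// ler_wpM2r ?pp// subr_ge0 ltW.
Qed.

Lemma stepsum_cst c a s : stepsum (fun _ _ => c) a s = c * (last a s - a).
Proof. by elim: s a => [|y s IH] a /=; rewrite ?IH; ring. Qed.

End step_functions.

Definition lower_semicontinuous_at {R : realType} (f : R -> R) (x : R) : Prop :=
  forall e, 0 < e -> exists p q, p < x < q /\ forall y, p < y < q -> f x - e <= f y.

Section riemann.
Context {R : realType}.
Local Notation mu := (@lebesgue_measure R).
Variables (f : R -> R) (a b C : R).
Hypotheses (ab : a < b) (f_ge0 : forall x, 0 <= f x) (f_leC : forall x, f x <= C).
Hypothesis f_riemann : lower_integral f a b = upper_integral f a b.

Let lowf (p q : R) := inf (f @` `[p, q]).
Let uppf (p q : R) := sup (f @` `[p, q]).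

Let lowf_le p q x : p <= x <= q -> lowf p q <= f x.
Proof.
move=> xpq; apply: ge_inf; last by exists x => //=; rewrite in_itv.
by exists 0 => _ [y _ <-].
Qed.

Let uppf_ge p q x : p <= x <= q -> f x <= uppf p q.
Proof.
move=> xpq; apply: ub_le_sup; last by exists x => //=; rewrite in_itv.
by exists C => _ [y _ <-].
Qed.

Let lowf_leC p q : p < q -> lowf p q <= C.
Proof. by move=> pq; apply: le_trans (f_leC p); apply: lowf_le; rewrite lexx ltW. Qed.

Let uppf_ge0 p q : p < q -> 0 <= uppf p q.
Proof. by move=> pq; apply: le_trans (f_ge0 p) _; apply: uppf_ge; rewrite lexx ltW. Qed.

Lemma riemann_gap e : 0 < e -> exists s t,
  [/\ itv_partition a b s, itv_partition a b t & upper_sum f a t - lower_sum f a s < e].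
Proof.
move=> e0; have e20 : 0 < e / 2 by rewrite divr_gt0.
have part : itv_partition a b [:: b] by split=> //=; rewrite ab.
have [_ [s ps <-] hs] : exists2 y, [set lower_sum f a s | s in itv_partition a b] y &
    lower_integral f a b - e / 2 < y.
  apply: sup_adherent => //; split; first by exists (lower_sum f a [:: b]), [:: b].
  exists (C * (b - a)) => _ [s [ps /eqP <-] <-].
  by rewrite lower_sumE -stepsum_cst; apply: le_stepsum => // p q; exact: lowf_leC.
have [_ [t pt <-] ht] : exists2 y, [set upper_sum f a s | s in itv_partition a b] y &
    y < upper_integral f a b + e / 2.
  apply: inf_adherent => //; split; first by exists (upper_sum f a [:: b]), [:: b].
  exists (0 * (b - a)) => _ [s' [ps' /eqP <-] <-].
  by rewrite upper_sumE -stepsum_cst; apply: le_stepsum => // p q; exact: uppf_ge0.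
exists s, t; split => //; move: hs ht; rewrite f_riemann; lra.
Qed.

(** At a point x both step functions bracket [f x], each on its own partition, so the gaps [D n] are
    nonnegative; their integrals are below [1 / (n + 1)]. The infimum [W] of the gaps therefore has
    integral 0 and vanishes almost everywhere. *)
Lemma riemann_ae_gap : exists s t : nat -> seq R,
  [/\ forall n, itv_partition a b (s n), forall n, itv_partition a b (t n) &
  {ae mu, forall x, forall e, 0 < e ->
    exists n, stepf uppf a (t n) x - stepf lowf a (s n) x < e}].
Proof.
have /choice[st stP] n : exists st : seq R * seq R, [/\ itv_partition a b st.1,
    itv_partition a b st.2 & upper_sum f a st.2 - lower_sum f a st.1 < harmonic n].
  by have [|s [t ?]] := @riemann_gap (harmonic n); [rewrite invr_gt0|exists (s, t)].
pose s n := (st n).1; pose t n := (st n).2; exists s, t.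
pose D n x := stepf uppf a (t n) x - stepf lowf a (s n) x.
have sP n : path <%R a (s n) /\ last a (s n) = b by have [[? /eqP]] := stP n.
have tP n : path <%R a (t n) /\ last a (t n) = b by have [_ [? /eqP]] := stP n.
have D0 n x : 0 <= D n x.
  have [ps ls] := sP n; have [pt lt] := tP n.
  rewrite /D; have [xa|ax] := ltP x a; first by rewrite !stepf_lt// subrr.
  have [xb|bx] := ltP x b; last by rewrite !stepf_ge ?ls ?lt// subrr.
  have [||p [q [_ /andP[px xq] _ _ ->]]] := @stepf_cell R lowf a (s n) x; rewrite ?ax ?ls//.
  have [||p' [q' [_ /andP[px' xq'] _ _ ->]]] := @stepf_cell R uppf a (t n) x; rewrite ?ax ?lt//.
  by rewrite subr_ge0 (le_trans (lowf_le (x := x) _))// ?uppf_ge ?px ?px' ?ltW.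
have iD n : mu.-integrable setT (EFin \o D n).
  have := integrableB measurableT (integrable_stepf uppf a (t n)) (integrable_stepf lowf a (s n)).
  by apply: eq_integrable.
have mD n : measurable_fun setT (EFin \o D n) by have /integrableP[] := iD n.
have intD n : (\int[mu]_x (D n x)%:E <= (harmonic n)%:E)%E.
  have : \int[mu]_x D n x <= harmonic n.
    rewrite RintegralB//; [|exact: integrable_stepf|exact: integrable_stepf].
    have [ps _] := sP n; have [pt _] := tP n; have [_ _ /ltW] := stP n.
    by rewrite !Rintegral_stepf// -upper_sumE -lower_sumE.
  by rewrite -lee_fin /Rintegral fineK//; exact: integrable_fin_num (iD n).
split=> [n|n|]; [by have [] := stP n|by have [] := stP n|].
pose W x := einfs (fun n => (D n x)%:E) 0.
have W0 x : (0 <= W x)%E by apply/ereal_infP => _ [n _ <-]; rewrite lee_fin.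
have WD n x : (W x <= (D n x)%:E)%E by apply: ereal_inf_lbound; exists n.
have mW : measurable_fun setT W by apply: measurable_fun_einfs; exact: mD.
have intW : (\int[mu]_x `|W x| = 0)%E.
  under eq_integral do rewrite gee0_abs//.
  apply/eqP; rewrite eq_le integral_ge0// andbT.
  apply/lee_addgt0Pr => e e0; rewrite add0e.
  have [n ne] : exists n, @harmonic R n <= e.
    have /cvgrPdist_le/(_ e e0)[n _ /(_ n (leqnn n))] := @cvg_harmonic R.
    by rewrite sub0r normrN => h; exists n; exact: le_trans (ler_norm _) h.
  apply: le_trans (_ : (\int[mu]_x (D n x)%:E <= _)%E).
    apply: ge0_le_integral => //; exact: mD.
  by rewrite (le_trans (intD n))// lee_fin.
have := (ae_eq_integral_abs mu measurableT mW).1 intW.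
apply: filterS => x /(_ I) Wx e e0.
have : (W x < e%:E)%E by rewrite Wx lte_fin.
by move=> /ereal_inf_lt[_ [n _ <-]]; rewrite lte_fin => ?; exists n.
Qed.

Lemma riemann_lower_semicontinuous : (forall x, f x != 0 -> a <= x <= b) ->
  {ae mu, forall x, lower_semicontinuous_at f x}.
Proof.
move=> f0; have [s [t [ps pt h]]] := riemann_ae_gap.
have c : {ae mu, forall x, ~ (\bigcup_n [set` a :: s n]) x}.
  apply: ae_countable; apply: bigcup_countable => // n _.
  exact/finite_set_countable/finite_seq.
have cb : {ae mu, forall x, ~ [set b] x} by apply: ae_countable; exact: countable1.
apply: filterS3 h c cb => x hx cx bx e e0.
(* Outside [[a, b[], with the point [b] discarded, [f x = 0] is a global minimum of [f]. *)
have [/andP[ax xb]|xab] := boolP (a <= x < b); last first.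
  have fx0 : f x = 0.
    apply/eqP; apply: contraNT xab => /f0/andP[-> /=]; rewrite le_eqVlt => /orP[/eqP xb|//].
    by case: bx.
  exists (x - 1), (x + 1); split; first by apply/andP; split; lra.
  by move=> y _; rewrite fx0 (le_trans _ (f_ge0 y))// sub0r oppr_le0 ltW.
have [n] := hx e e0; have [pathS /eqP lastS] := ps n; have [pathT /eqP lastT] := pt n.
have [||p [q [pa /andP[px xq] _ _ ->]]] := @stepf_cell R lowf a (s n) x; rewrite ?ax ?lastS//.
have [||p' [q' [_ /andP[px' xq'] _ _ ->]]] := @stepf_cell R uppf a (t n) x; rewrite ?ax ?lastT//.
(* The lower cell of x is the required neighbourhood: x is not a partition point, hence interior,
   and the infimum over the cell exceeds the upper value, so also [f x], minus [e]. *)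
move=> gap; exists p, q; split.
  rewrite xq andbT lt_neqAle px andbT; apply/eqP => pE; apply: cx; exists n => //=.
  by rewrite -pE.
move=> y /andP[py yq]; apply: le_trans (lowf_le (p := p) (q := q) _); last by rewrite !ltW.
have := uppf_ge (p := p') (q := q') (x := x); rewrite px' ltW// => /(_ isT); lra.
Qed.

End riemann.

(** * Sums of dyadic squares *)

Section dyadic_squares.
Context {R : realType}.
Variables (f : R -> R) (K : nat) (C : R).
Hypotheses (f_ge0 : forall x, 0 <= f x) (f_leC : forall x, f x <= C).
Hypothesis f_supp : forall x, f x != 0 -> - K%:R <= x < K%:R.

Let pow2 k : R := 2 ^+ k.

Let pow2_gt0 k : 0 < pow2 k. Proof. exact: exprn_gt0. Qed.

Let node k i : R := i%:R / pow2 k - K%:R.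

(** Stated in the scaled variable [(x + K) 2^k], so that the index of a cell is an integer part. As
    [truncn] sends negative numbers to 0, [idx] is meaningful only for [x >= -K]. *)
Let cell k i : set R := [set x | i%:R <= (x + K%:R) * pow2 k < i.+1%:R].

Let idx k (x : R) : nat := Num.truncn ((x + K%:R) * pow2 k).

(* The largest number of squares of side 2^-k that fit below f, stacked on the
   i-th cell of level k. *)
Let fit k i : nat := Num.truncn (inf (f @` cell k i) * pow2 k).

(** The parent cell [i./2] already carries [fit k' i./2] squares of double side, which fill the
    height of twice as many squares of the present side. *)
Let new k i : nat := if k is k'.+1 then (fit k i - (fit k' i./2).*2)%N else fit 0 i.

Let square k i : seq (R * R) := [:: (node k i, node k i.+1); (node k i.+1, node k i)].

(** There are [K.*2 * 2 ^ k] cells of side [2^-k] in [[-K, K[]. *)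
Let level k := flatten [seq flatten (nseq (new k i) (square k i)) | i <- iota 0 (K.*2 * 2 ^ k)].

(* The dummy pair (0, 0) makes the size of [levels k] exceed k. *)
Let Fixpoint levels k : seq (R * R) :=
  (if k is k'.+1 then levels k' else [::]) ++ (0, 0) :: level k.

(** Each [levels k] is a prefix of the next and [levels n] has more than n entries, so this reads
    off the n-th term of the infinite concatenation. *)
Definition squares n : R * R := nth (0, 0) (levels n) n.

Let trisum (s : seq (R * R)) x := \sum_(p <- s) tri p.1 p.2 x.

Let trisum_cat s t x : trisum (s ++ t) x = trisum s x + trisum t x.
Proof. exact: big_cat. Qed.

Let trisum_flatten ss x : trisum (flatten ss) x = \sum_(s <- ss) trisum s x.
Proof. exact: big_flatten. Qed.

Let shift_ge0 k x : - K%:R <= x -> 0 <= (x + K%:R) * pow2 k.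
Proof. by move=> Kx; apply: mulr_ge0; [rewrite -lerBlDr sub0r|exact: ltW]. Qed.

Let mem_cell k i x : - K%:R <= x -> cell k i x <-> i = idx k x.
Proof.
move=> Kx; split=> [/truncn_def <-//|->]; exact/truncn_itv/shift_ge0.
Qed.

(** On the cell from u to v the two triangles add up to [(x - u) + (v - x) = 2^-k]; half-open cells
    ensure that neighbours do not overlap. *)
Let square_sum k i x :
  trisum (square k i) x = ((- K%:R <= x) && (i == idx k x))%:R / pow2 k.
Proof.
have uv : node k i < node k i.+1 by rewrite ltrD2r ltr_pM2r ?invr_gt0// ltr_nat.
rewrite /trisum !big_cons big_nil addr0 /tri/= (min_l (ltW uv)) (max_r (ltW uv)).
rewrite (min_r (ltW uv)) (max_l (ltW uv)) -mulrDl.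
have cellE : (x \in `[node k i, node k i.+1[%classic) = (- K%:R <= x) && (i == idx k x).
  have -> : (x \in `[node k i, node k i.+1[%classic) =
      (i%:R <= (x + K%:R) * pow2 k < i.+1%:R).
    by rewrite mem_setE in_itv/= /node lerBlDr ltrBrDr ler_pdivrMr// ltr_pdivlMr.
  have [Kx|xK] := leP (- K%:R) x.
    by apply/idP/eqP => [/(mem_cell _ _ Kx)|/(mem_cell k i Kx)].
  apply/negbTE; rewrite negb_and -ltNge; apply/orP; left.
  by rewrite (lt_le_trans (y := 0))// nmulr_rlt0// -ltrBrDr sub0r.
rewrite indicE; have [xc|xc] := boolP (x \in _); last first.
  by rewrite -cellE (negPf xc) mulr0 mul0r.
rewrite -cellE xc mulr1 mul1r; move: xc; rewrite inE/= in_itv/= => /andP[ux xv].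
rewrite ler0_norm ?subr_le0// ger0_norm ?subr_ge0 1?ltW//.
by rewrite opprB addrC subrKA /node -natr1; field; rewrite gt_eqF.
Qed.

Let level_sum k x : trisum (level k) x =
  if - K%:R <= x < K%:R then (new k (idx k x))%:R / pow2 k else 0.
Proof.
have nsum i : trisum (flatten (nseq (new k i) (square k i))) x =
    (new k i)%:R * trisum (square k i) x.
  elim: (new k i) => [|n IH]; first by rewrite /trisum big_nil mul0r.
  rewrite -[flatten _]/(square k i ++ flatten (nseq n (square k i))).
  by rewrite trisum_cat IH -natr1; ring.
rewrite /level trisum_flatten big_map.
under eq_bigr => i _ do rewrite nsum square_sum.
have [Kx|xK]/= := leP (- K%:R) x; last by rewrite big1// => i _; rewrite !mul0r mulr0.
have -> : (x < K%:R) = (idx k x < K.*2 * 2 ^ k)%N.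
  rewrite truncn_lt_nat; last exact: shift_ge0.
  by rewrite natrM natrX ltr_pM2r// -addnn natrD ltrD2r.
rewrite -{1}[(K.*2 * 2 ^ k)%N]subn0 big_mkord.
case: ltnP => [lt_idx|le_idx].
  rewrite (bigD1 (Ordinal lt_idx))//= eqxx mul1r big1 ?addr0// => i /eqP/val_eqP/negPf/= ->.
  by rewrite mul0r mulr0.
rewrite big1// => i _; rewrite (_ : _ == _ = false) ?mul0r ?mulr0//.
by apply/negbTE; rewrite ltn_eqF// (leq_trans _ le_idx).
Qed.

Let half_natr n : n%:R = (odd n)%:R + 2 * n./2%:R :> R.
Proof. by rewrite -{1}[n]odd_double_half natrD -muln2 natrM mulrC. Qed.

Let idxS k x : - K%:R <= x -> (idx k.+1 x)./2 = idx k x.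
Proof.
move=> Kx; apply/esym/truncn_def.
have /andP[h1 h2] := truncn_itv (shift_ge0 k.+1 Kx); move: h1 h2; rewrite -/(idx _ _) => h1 h2.
have E : (x + K%:R) * pow2 k.+1 = 2 * ((x + K%:R) * pow2 k) by rewrite /pow2 exprS; ring.
have jE := half_natr (idx k.+1 x); rewrite E -[(idx _ _).+1%:R]natr1 jE in h2; rewrite E jE in h1.
by rewrite -[(_./2).+1%:R]natr1; move: h1 h2; case: (odd _) => /= h1 h2; apply/andP; split; lra.
Qed.

Let cellS k j : cell k.+1 j `<=` cell k j./2.
Proof.
move=> x /= /andP[h1 h2].
have E : (x + K%:R) * pow2 k.+1 = 2 * ((x + K%:R) * pow2 k) by rewrite /pow2 exprS; ring.
have jE := half_natr j; rewrite E -[j.+1%:R]natr1 jE in h2; rewrite E jE in h1.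
by rewrite /cell/= -[(j./2).+1%:R]natr1; move: h1 h2; case: (odd _) => /= h1 h2; apply/andP; split; lra.
Qed.

Let cell_nonempty k i : f @` cell k i !=set0.
Proof.
exists (f (node k i)), (node k i) => //; rewrite /cell/= /node subrK divfK ?gt_eqF//.
by rewrite lexx ltr_nat leqnn.
Qed.

Let inf_cell_ge0 k i : 0 <= inf (f @` cell k i).
Proof. by apply: lb_le_inf => // _ [y _ <-]. Qed.

Let inf_cell_pow_ge0 k l i : 0 <= inf (f @` cell k i) * pow2 l.
Proof. by apply: mulr_ge0; [exact: inf_cell_ge0|exact: ltW]. Qed.

Let inf_cell_le k i x : cell k i x -> inf (f @` cell k i) <= f x.
Proof. by move=> cx; apply: ge_inf; [exists 0 => _ [y _ <-]|exists x]. Qed.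

(** Ensures that the subtraction of naturals in [new] is never cut off at 0: the infimum over a cell
    is at least that over its parent, and scaling by 2 doubles the integer part or more. *)
Let fitS k j : ((fit k j./2).*2 <= fit k.+1 j)%N.
Proof.
rewrite /fit truncn_ge_nat; last exact: inf_cell_pow_ge0.
rewrite -muln2 natrM mulrC /pow2 exprS mulrCA ler_pM2l//.
apply: (@le_trans _ _ (inf (f @` cell k j./2) * pow2 k)).
  by rewrite truncn_le inf_cell_pow_ge0.
rewrite ler_pM2r//; apply: lb_le_inf => // _ [y yj <-].
by apply: inf_cell_le; exact: cellS.
Qed.

Let tri00 x : tri 0 0 x = 0 :> R.
Proof. by rewrite /tri minxx maxxx set_itv_ge ?bnd_simp ?ltxx// indic0 mulr0. Qed.

Let trisum_dummy s x : trisum ((0, 0) :: s) x = trisum s x.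
Proof. by rewrite /trisum big_cons tri00 add0r. Qed.

Let levelsS k : levels k.+1 = levels k ++ (0, 0) :: level k.+1.
Proof. by []. Qed.

(** Telescoping: on the cell of x, the squares of all levels up to k reach exactly the greatest
    multiple of [2^-k] that is at most the infimum of [f]. *)
Let levels_sum k x : trisum (levels k) x =
  if - K%:R <= x < K%:R then (fit k (idx k x))%:R / pow2 k else 0.
Proof.
elim: k => [|k IH]; first by rewrite trisum_dummy level_sum.
rewrite levelsS trisum_cat trisum_dummy IH level_sum.
case: ifP => [/andP[Kx _]|_]; last by rewrite addr0.
rewrite /new natrB ?fitS// idxS// -muln2 natrM /pow2 exprS.
by field; rewrite gt_eqF//.
Qed.

Let levels_sum_le k x : trisum (levels k) x <= f x.
Proof.
rewrite levels_sum; case: ifP => // /andP[Kx _]; rewrite ler_pdivrMr//.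
apply: (@le_trans _ _ (inf (f @` cell k (idx k x)) * pow2 k)).
  by rewrite truncn_le inf_cell_pow_ge0.
by rewrite ler_pM2r// inf_cell_le//; apply/mem_cell.
Qed.

Let size_levels k : (k < size (levels k))%N.
Proof.
elim: k => [|k IH] //=; rewrite size_cat /= addnS ltnS.
by rewrite (leq_trans IH)// leq_addr.
Qed.

Let nth_levels j k n : (j <= k)%N -> (n < size (levels j))%N ->
  nth (0, 0) (levels k) n = nth (0, 0) (levels j) n.
Proof.
move=> jk nj; elim: k jk => [|k IH]; first by rewrite leqn0 => /eqP ->.
rewrite leq_eqVlt => /orP[/eqP->//|]; rewrite ltnS => jk.
rewrite -IH//= nth_cat (leq_trans nj)//.
elim: k jk {IH} => [|k IH]; first by rewrite leqn0 => /eqP ->.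
rewrite leq_eqVlt => /orP[/eqP->//|]; rewrite ltnS => /IH h.
by rewrite (leq_trans h)//= size_cat leq_addr.
Qed.

Let squaresE k n : (n < size (levels k))%N -> squares n = nth (0, 0) (levels k) n.
Proof.
move=> nk; rewrite /squares; have [nk'|kn] := leqP k n.
  exact: nth_levels.
by apply/esym; apply: nth_levels; [exact: ltnW|exact: size_levels].
Qed.

Let partial_sum N x := \sum_(n < N) tri (squares n).1 (squares n).2 x.

Let partial_sum_levels k x : partial_sum (size (levels k)) x = trisum (levels k) x.
Proof.
rewrite /trisum (big_nth (0, 0)) big_mkord; apply: eq_bigr => n _.
by rewrite (squaresE (ltn_ord n)).
Qed.

Let le_partial_sum N N' x : (N <= N')%N -> partial_sum N x <= partial_sum N' x.
Proof.
move=> NN'; rewrite /partial_sum -!(big_mkord xpredT (fun n => tri (squares n).1 (squares n).2 x)).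
by rewrite (@big_cat_nat _ _ _ N 0 N')//= lerDl sumr_ge0// => n _; exact: tri_ge0.
Qed.

Lemma squares_sum_le N x : partial_sum N x <= C.
Proof.
rewrite (le_trans (le_partial_sum x (ltnW (size_levels N))))// partial_sum_levels.
exact: le_trans (levels_sum_le _ _) (f_leC x).
Qed.

Let node_bounded k i : (i <= K.*2 * 2 ^ k)%N -> `|node k i| <= K%:R.
Proof.
move=> iN; have i0 : 0 <= i%:R / pow2 k by apply: divr_ge0 => //; exact: ltW.
rewrite /node ler_norml; apply/andP; split; first by rewrite lerBrDr addNr.
rewrite lerBlDr ler_pdivrMr//.
by rewrite /pow2 -natrD addnn -natrX -natrM ler_nat.
Qed.

Let levels_bounded k p : p \in levels k -> `|p.1| <= K%:R /\ `|p.2| <= K%:R.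
Proof.
have lev j q : q \in level j -> `|q.1| <= K%:R /\ `|q.2| <= K%:R.
  move=> /flattenP[_ /mapP[i + ->] /flattenP[r /nseqP[-> _]]].
  rewrite mem_iota add0n => /andP[_ iN]; rewrite !inE => /orP[]/eqP ->/=.
    by split; apply: node_bounded => //; exact: ltnW.
  by split; apply: node_bounded => //; exact: ltnW.
have dummy q j : q \in (0, 0) :: level j -> `|q.1| <= K%:R /\ `|q.2| <= K%:R.
  by rewrite inE => /orP[/eqP->|/lev//]; rewrite /= normr0.
elim: k => [|k IH]; first exact: dummy.
by rewrite levelsS mem_cat => /orP[/IH|/dummy].
Qed.

Lemma squares_bounded n : `|(squares n).1| <= K%:R /\ `|(squares n).2| <= K%:R.
Proof. by apply: (@levels_bounded n); rewrite mem_nth. Qed.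

(** Two losses separate the stack from [f x]: the infimum over a cell small enough to fit in the
    interval of semicontinuity loses at most [e / 2], and rounding down to a multiple of [2^-k]
    loses at most [2^-k]. *)
Let levels_cvg x : lower_semicontinuous_at f x ->
  trisum (levels k) x @[k --> \oo] --> f x.
Proof.
move=> lsc; have [xK|xK] := boolP (- K%:R <= x < K%:R); last first.
  have -> : f x = 0 by apply/eqP; apply: contraNT xK => /f_supp.
  by apply: cvg_near_cst; apply: nearW => k; rewrite levels_sum (negPf xK).
have Kx : - K%:R <= x by case/andP: xK.
apply/cvgrPdist_le => e e0; have e20 : 0 < e / 2 by rewrite divr_gt0.
have [p [q [/andP[px xq] fpq]]] := lsc _ e20.
have small d : 0 < d -> \forall k \near \oo, (pow2 k)^-1 <= d.
  move=> d0; have /cvgrPdist_le/(_ d d0) := @cvg_harmonic R.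
  apply: filterS => k; rewrite sub0r normrN => /(le_trans (ler_norm _)).
  apply: le_trans; rewrite lef_pV2 ?posrE// /pow2 -natrX ler_nat.
  by rewrite ltn_expl.
near=> k.
have k1 : (pow2 k)^-1 <= (x - p) / 2 by near: k; apply: small; rewrite divr_gt0 ?subr_gt0.
have k2 : (pow2 k)^-1 <= (q - x) / 2 by near: k; apply: small; rewrite divr_gt0 ?subr_gt0.
have k3 : (pow2 k)^-1 <= e / 2 by near: k; exact: small.
rewrite ger0_norm ?subr_ge0 ?levels_sum_le// lerBlDr levels_sum xK.
have cx : cell k (idx k x) x by exact/mem_cell.
have inf_ge : f x - e / 2 <= inf (f @` cell k (idx k x)).
  apply: lb_le_inf => // _ [y cy <-]; apply: fpq.
  have : `|y - x| <= (pow2 k)^-1.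
    rewrite -[leRHS]mul1r ler_pdivlMr// -[X in _ * X]gtr0_norm// -normrM.
    move: cx cy; rewrite /cell/= -!natr1 => /andP[h1 h2] /andP[h3 h4].
    rewrite (_ : (y - x) * pow2 k = (y + K%:R) * pow2 k - (x + K%:R) * pow2 k); last by ring.
    by rewrite ler_norml; apply/andP; split; lra.
  by rewrite ler_norml => /andP[]; move=> *; apply/andP; split; lra.
have : inf (f @` cell k (idx k x)) - (pow2 k)^-1 <= (fit k (idx k x))%:R / pow2 k.
  rewrite ler_pdivlMr// mulrBl mulVf ?gt_eqF// lerBlDr natr1.
  by apply/ltW; exact: truncnS_gt.
lra.
Unshelve. all: by end_near. Qed.

Lemma squares_cvg x : lower_semicontinuous_at f x ->
  tri_sum (fun n => (squares n).1) (fun n => (squares n).2) x = f x.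
Proof.
move=> lsc; have cS := cvg_tri_sum (a := fun n => (squares n).1) (b := fun n => (squares n).2)
  squares_sum_le (x := x).
have SE N : series (fun n => tri (squares n).1 (squares n).2 x) N = partial_sum N x.
  by rewrite /series/= big_mkord.
have le_lim N : partial_sum N x <= tri_sum (fun n => (squares n).1) (fun n => (squares n).2) x.
  rewrite -SE -(cvg_lim (@Rhausdorff R) cS); apply: nondecreasing_cvgn_le; last exact: cvgP cS.
  by apply/nondecreasing_seqP => m; rewrite !SE le_partial_sum.
have cL : trisum (levels k) x @[k --> \oo] -->
    tri_sum (fun n => (squares n).1) (fun n => (squares n).2) x.
  (* The k-th full stack has more than k triangles, so it lies between the k-th partial sum and the
     limit. *)
  apply: squeeze_cvgr cS (cvg_cst _).
  apply: nearW => k; rewrite SE -partial_sum_levels le_lim andbT.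
  exact/le_partial_sum/ltnW.
by rewrite -(cvg_lim (@Rhausdorff R) cL); exact: cvg_lim (levels_cvg lsc).
Qed.

End dyadic_squares.

Lemma riemann_tri_sum {R : realType} (f : R -> R) : (forall x, 0 <= f x) ->
  riemann_integrable f -> exists (a b : R^nat) (M C : R),
    [/\ forall k, `|a k| <= M, forall k, `|b k| <= M,
        forall N x, \sum_(n < N) tri (a n) (b n) x <= C &
        {ae lebesgue_measure, forall x, tri_sum a b x = f x}].
Proof.
move=> f_ge0 [a [b [ab f0 [[M fM] fE]]]].
have f_leC x : f x <= Num.max 0 M.
  rewrite le_max; have [->|/f0 xab] := eqVneq (f x) 0; first by rewrite lexx.
  by rewrite (le_trans (ler_norm _) (fM x xab)) orbT.
(* The support has to lie in the half-open [[-K, K[], hence an integer strictly above [|a|] and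
   [|b|]. *)
pose K := (Num.truncn `|a| + Num.truncn `|b|).+2.
have aK : `|a| < K%:R.
  by rewrite (lt_le_trans (truncnS_gt _))// ler_nat /K !ltnS leqW// leq_addr.
have bK : `|b| < K%:R.
  by rewrite (lt_le_trans (truncnS_gt _))// ler_nat /K !ltnS leqW// leq_addl.
have f_supp x : f x != 0 -> - K%:R <= x < K%:R.
  move=> /f0/andP[ax xb]; move: aK bK; rewrite !ltr_norml.
  by move=> /andP[? ?] /andP[? ?]; apply/andP; split; lra.
exists (fun n => (squares f K n).1), (fun n => (squares f K n).2), K%:R, (Num.max 0 M).
split=> [k|k|N x|].
- by have [] := squares_bounded f K k.
- by have [] := squares_bounded f K k.
- exact: squares_sum_le.
have := riemann_lower_semicontinuous ab f_ge0 f_leC fE f0.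
by apply: filterS => x; exact: squares_cvg.
Qed.

(** * Separability *)

Section l2_separable.
Variable R : realType.

(** Finitely supported vectors with coordinates in Q(i), indexed by a countable type. *)
Definition ratvec (s : seq (rat * rat)) : l2 R :=
  \sum_(i < size s) (ratr (s`_i).1 +i* ratr (s`_i).2) *: std i.

Lemma ratvecE s k : ratvec s k = (ratr (s`_k).1 +i* ratr (s`_k).2)%R.
Proof.
rewrite /ratvec l2_sum; under eq_bigr do rewrite l2Z stdE.
have [ks|sk] := ltnP k (size s).
  rewrite (bigD1 (Ordinal ks))//= eqxx mulr1 big1 ?addr0// => i.
  by rewrite -val_eqE/= eq_sym => /negPf ->; rewrite mulr0.
rewrite nth_default//= big1 => [|i _]; first by rewrite !rmorph0.
by rewrite eq_sym (ltn_eqF (leq_trans (ltn_ord i) sk)) mulr0.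
Qed.

Lemma rat_approx (z : R[i]) (e : R) : 0 < e ->
  exists q : rat * rat, sqnorm (z - (ratr q.1 +i* ratr q.2)) <= e.
Proof.
move=> e0; pose t := Num.sqrt (e / 2); have t0 : 0 < t by rewrite sqrtr_gt0 divr_gt0.
have tE : t ^+ 2 = e / 2 by rewrite sqr_sqrtr// ltW// divr_gt0.
have approx (u : R) : exists q : rat, (u - ratr q) ^+ 2 <= t ^+ 2.
  have [|q] := @rat_in_itvoo _ (u - t) (u + t); first lra.
  rewrite in_itv/= => /andP[q1 q2]; exists q.
  by move: (ratr q : R) q1 q2 => w w1 w2; nra.
have [q1 h1] := approx (Re z); have [q2 h2] := approx (Im z).
exists (q1, q2); rewrite /sqnorm Re_add Im_add Re_opp Im_opp/=; lra.
Qed.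

Lemma ratvec_approx (x : l2 R) (e : R) : 0 < e -> exists s, `|x - ratvec s| <= e%:C.
Proof.
move=> e0; have e20 : 0 < e ^+ 2 / 2 by rewrite divr_gt0// exprn_gt0.
have [N tail] : exists N, limn [series sqnorm (x k)]_k - \sum_(k < N) sqnorm (x k) <= e ^+ 2 / 2.
  have /cvgrPdist_le/(_ _ e20)[N _ hN] := @l2_summable _ x.
  exists N; have := hN N (leqnn N); rewrite /series/= big_mkord; exact: le_trans (ler_norm _).
(* Half of [e^2] is left to the tail beyond [N]; the other half is shared among the first [N]
   coordinates, with [N.+1] in place of [N] to avoid a zero divisor. *)
have d0 : 0 < e ^+ 2 / 2 / N.+1%:R by rewrite divr_gt0.
have [r rP] := choice (fun k => rat_approx (x k) d0).
exists (mkseq r N); apply: l2_norm_le (ltW e0) _ => n.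
pose u k := sqnorm ((x - ratvec (mkseq r N)) k).
have uN k : (k < N)%N -> u k <= e ^+ 2 / 2 / N.+1%:R.
  by move=> kN; rewrite /u l2B ratvecE nth_mkseq//; exact: rP.
have uT k : (N <= k)%N -> u k = sqnorm (x k).
  by move=> Nk; rewrite /u l2B ratvecE nth_default ?size_mkseq// !rmorph0 subr0.
have u_head : \sum_(k < N) u k <= e ^+ 2 / 2.
  apply: le_trans (_ : \sum_(k < N) (e ^+ 2 / 2 / N.+1%:R) <= _).
    by apply: ler_sum => k _; exact: uN.
  rewrite sumr_const card_ord -[_ *+ N]mulr_natr mulrAC ler_pdivrMr// ler_wpM2l ?(ltW e20)//.
  by rewrite ler_nat.
have u_split m (v : nat -> R) : \sum_(k < N + m) v k = \sum_(k < N) v k + \sum_(k < m) v (N + k)%N.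
  by rewrite big_split_ord.
apply: le_trans (_ : \sum_(k < N + n) u k <= _).
  rewrite addnC big_split_ord/= lerDl sumr_ge0// => k _; exact: sqnorm_ge0.
have := sqnorm_sum_le x (N + n); rewrite (u_split n u) (u_split n (fun k => sqnorm (x k))).
have -> : \sum_(k < n) u (N + k)%N = \sum_(k < n) sqnorm (x (N + k)%N).
  by apply: eq_bigr => k _; rewrite uT ?leq_addr.
lra.
Qed.

Lemma l2_separable : separable_space (l2 R).
Proof.
exists (range ratvec); first exact: sub_countable (card_image_le _ _) (countableP _).
move=> O [x Ox] Oo; have /nbhs_ballP[e e0 eO] := open_nbhs_nbhs (conj Oo Ox).
case: e e0 eO => e e' /=; rewrite ltcE/= => /andP[/eqP -> e0] eO.
have [|s xs] := @ratvec_approx x (e / 2); first exact: divr_gt0.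
exists (ratvec s); split; last by exists s.
apply: eO; rewrite -ball_normE/=; apply: le_lt_trans xs _.
by rewrite ltcR; lra.
Qed.

End l2_separable.

Theorem theorem6p1 (R : realType) (eta0 : R -> R)
    (eta0_ge0 : forall x : R, 0 <= eta0 x)
    (eta0_supp : compactly_supported eta0)
    (eta0_int : riemann_integrable eta0) :
  exists (H : hilbertType R) (A B : H -> H),
    [/\ separable_space H,
        bounded_op A /\ self_adjoint A,
        bounded_op B /\ self_adjoint B,
        hilbert_schmidt (A - B) &
        exists2 eta : R -> R, is_KoSSF A B eta &
          {ae lebesgue_measure, forall x : R, eta x = eta0 x}].
Proof.
have [a [b [M [C [aM bM sumC eta0E]]]]] := riemann_tri_sum eta0_ge0 eta0_int.
have raM := bounded_by_real aM; have rbM := bounded_by_real bM.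
exists (l2 R), (rdiag a), (rdiag b); split.
- exact: l2_separable.
- split; [exact: diag_bounded raM|exact: diag_self_adjoint aM].
- split; [exact: diag_bounded rbM|exact: diag_self_adjoint bM].
- rewrite /rdiag (diagB raM rbM); apply: diag_hilbert_schmidt (bounded_byB raM rbM) _.
  under eq_fun do rewrite -rmorphB/= cabs_real real_normK ?num_real//.
  exact: cvg_sum_sqr aM bM sumC.
- by exists (tri_sum a b) => //; exact: KoSSF_rdiag aM bM sumC.
Qed.
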